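(* Let $\widehat m^*=(\widehat m^*_{ij})$ be the estimator $\widehat m^*_{ij}=\widehat m^*_{i\cdot}\,\widehat p_{ij}$ with $\widehat m^*_{i\cdot}=X^*_i/n^*$ (first-stage MLE from the prior sample) and $\widehat p_i=(\widehat p_{ij})_j$ the MLE of the $i$-th second-stage model from the present sample. Then, as $n,n^*\to\infty$, its risk satisfies $$ \begin{aligned} \overset{-1}{ED}[\widehat m^*:m]&=\frac{1}{2n^*}(I-1)+\frac{1}{2n}\sum_{i=1}^I s_i+\frac{1}{12{n^*}^2}(M_f-1)\\ &\quad+\frac{1}{24n^2}\sum_{i=1}^I m_{i\cdot}^{-1}\Bigl(A_{(i)}+12(1-m_{i\cdot})s_i\Bigr)+o(n^{-2})+o({n^*}^{-2}). \end{aligned} $$ In the special case when all second-stage models are full models, $$ \begin{aligned} \overset{-1}{ED}[\widehat m^*:m]&=\frac{1}{2n^*}(I-1)+\frac{1}{2n}(p+1-I)+\frac{1}{12{n^*}^2}(M_f-1)\\ &\quad+\frac{1}{12n^2}\Bigl(M+\sum_{i=1}^I m_{i\cdot}^{-1}(6J_i-7)-6(p+1-I)\Bigr)+o(n^{-2})+o({n^*}^{-2}). \end{aligned} $$ Here $M_f=\sum_{i=1}^I m_{i\cdot}^{-1}$, $M=\sum_{i=1}^I\sum_{j=1}^{J_i}m_{ij}^{-1}$ and $p=\sum_{i=1}^I J_i-1$.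
   Context: Two-stage multinomial model. There are categories $C_{ij}$, $i=1,\dots,I$, $j=1,\dots,J_i$ ($J_i\ge 1$), with fixed true probabilities $m=(m_{ij})$, $m_{ij}>0$, $\sum_{i,j}m_{ij}=1$. Put $m_{i\cdot}=\sum_{j=1}^{J_i}m_{ij}$, $p_{ij}=m_{ij}/m_{i\cdot}$, $m_f=(m_{1\cdot},\dots,m_{I\cdot})$, $p_i=(p_{i1},\dots,p_{iJ_i})$. The first-stage model (for $m_f$) is a full model: no restriction other than positivity and summing to 1, so its dimension is $I-1$. The $i$-th second-stage model is a parametric model for $p_i$ (multinomial on the $J_i$ categories $C_{i1},\dots,C_{iJ_i}$, conditional on membership in $C_{i\cdot}=\bigcup_j C_{ij}$) of dimension $s_i\le J_i-1$; it is called full if $s_i=J_i-1$, i.e. no restriction on $p_i$ other than positivity and summing to 1. If $J_i=1$ then $p_{i1}=\widehat p_{i1}=1$ and there is no unknown parameter. Present survey: a random sample of size $n$ from this model, with counts $X_{ij}$ in $C_{ij}$, i.e. $(X_{ij})$ is multinomial with size $n$ and probabilities $(m_{ij})$; $X_{i\cdot}=\sum_j X_{ij}$. Prior survey: a random sample of size $n^*$, independent of the present survey, recording only the first-stage categories: $(X^*_1,\dots,X^*_I)$ is multinomial with size $n^*$ and probabilities $m_f$. Second-stage estimator: $\widehat p_i=(\widehat p_{i1},\dots,\widehat p_{iJ_i})$ is the maximum likelihood estimator of $p_i$ in the $i$-th second-stage model based on $(X_{i1},\dots,X_{iJ_i})$, which conditionally on $X_{i\cdot}$ is a multinomial sample of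 size $X_{i\cdot}$ with probabilities $p_i$; for a full model $\widehat p_{ij}=X_{ij}/X_{i\cdot}$. Kullback–Leibler divergence and risk: for probability vectors, $\overset{-1}{D}[q:r]=\sum_k q_k\log(q_k/r_k)$ (with $0\log 0=0$), so $\overset{-1}{D}[\widehat m^*:m]=\sum_{i,j}\widehat m^*_{ij}\log(\widehat m^*_{ij}/m_{ij})$; the risk is $\overset{-1}{ED}[\widehat m^*:m]=E\bigl[\overset{-1}{D}[\widehat m^*:m]\bigr]$. Samples with some $X_{i\cdot}=0$ are discarded: expectations are taken conditionally on the event $X_{i\cdot}\ne0$ for all $1\le i\le I$. Coefficients $A_{(i)}$: $A_{(i)}$ denotes the coefficient of $1/(24n^2)$ in the asymptotic expansion of the risk of the MLE of the $i$-th second-stage model when that model is observed with a (non-random) sample size $n$; that is, the $i$-th second-stage model is such that, for the MLE $\widehat p_i$ based on a multinomial sample of size $n$ with probabilities $p_i$, $$E\bigl[\overset{-1}{D}[\widehat p_i:p_i]\bigr]=\frac{s_i}{2n}+\frac{1}{24n^2}A_{(i)}+o(n^{-2})\quad (n\to\infty).$$ *)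

(* Defs.v *)
From HB Require Import structures.
From mathcomp Require Import all_boot all_order all_algebra.
From mathcomp Require Import all_classical all_reals all_analysis.

Set Implicit Arguments.
Unset Strict Implicit.
Unset Printing Implicit Defensive.

Import Order.TTheory GRing.Theory Num.Theory.
Import numFieldNormedType.Exports.

Local Open Scope classical_set_scope.
Local Open Scope ring_scope.

(* The term with q a = 0 vanishes, which is the convention 0 log 0 = 0. The
   divergence is only meaningful for positive r (ln 0 = 0 and x / 0 = 0). *)
Definition KL (R : realType) (K : finType) (q r : K -> R) : R :=
  \sum_a q a * ln (q a / r a).

Definition multinomial_pmf (R : realType) (K : finType) (k : nat) (q : K -> R)
    (x : K -> nat) : R :=
  if (\sum_a x a)%N == k then
    (k`!)%:R / (\prod_a (x a)`!)%:R * \prod_a q a ^+ x a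
  else 0.

Definition multinomial_law (R : realType) (d : measure_display)
    (T : measurableType d) (P : probability T R) (K : finType)
    (Y : K -> {RV P >-> nat}) (k : nat) (q : K -> R) : Prop :=
  forall x : K -> nat,
    P [set t | forall a, Y a t = x a] = (multinomial_pmf k q x)%:E.

Definition independent_counts (R : realType) (d : measure_display)
    (T : measurableType d) (P : probability T R) (K L : finType)
    (Y : K -> {RV P >-> nat}) (Z : L -> {RV P >-> nat}) : Prop :=
  forall (A : set (K -> nat)) (B : set (L -> nat)),
    P ([set t | A (fun a => Y a t)] `&` [set t | B (fun b => Z b t)]) =
    (P [set t | A (fun a => Y a t)] * P [set t | B (fun b => Z b t)])%E.

(* E[f | A] for an event A of positive probability *)
Definition cond_expectation (R : realType) (d : measure_display)
    (T : measurableType d) (P : probability T R) (A : set T) (f : T -> R) : R :=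
  fine 'E_P[f \* \1_A] / fine (P A).

Definition open_simplex (R : realType) (J : nat) : set 'rV[R]_J :=
  [set q | (forall j, 0 < q ord0 j) /\ \sum_j q ord0 j = 1].

(* An s-dimensional parametric model on J categories, given by its parameter
   space Theta and the map f sending a parameter to a probability vector. The
   Jacobian acts on row vectors, so row_free says that the differential of f is
   injective. *)
Definition parametric_model (R : realType) (J s : nat) (Theta : set 'rV[R]_s)
    (f : 'rV[R]_s -> 'rV[R]_J) : Prop :=
  open Theta /\
  forall theta, Theta theta ->
    [/\ open_simplex (f theta),
        differentiable f theta,
        {for theta, continuous (fun u => 'J f u)} &
        row_free ('J f theta)].

Definition full_model (R : realType) (J s : nat) (Theta : set 'rV[R]_s)
    (f : 'rV[R]_s -> 'rV[R]_J) : Prop :=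
  s = J.-1 /\ f @` Theta = @open_simplex R J.

(* The likelihood is maximised over the closure of the model M: a model consists
   of positive vectors, whereas X_j / X, the MLE of the full model, may have zero
   entries. *)
Definition is_MLE (R : realType) (J : nat) (M : set 'rV[R]_J)
    (x : 'I_J -> nat) (q : 'rV[R]_J) : Prop :=
  closure M q /\
  forall r, closure M r ->
    multinomial_pmf (\sum_j x j)%N (r ord0) x <=
    multinomial_pmf (\sum_j x j)%N (q ord0) x.

(* [category J] is the type of pairs (i, j) with j < J i. *)
Definition category (I : nat) (J : 'I_I -> nat) : finType :=
  {i : 'I_I & 'I_(J i)}.

Definition Cat (I : nat) (J : 'I_I -> nat) (i : 'I_I) (j : 'I_(J i)) :
    category J :=
  Tagged (fun i => 'I_(J i)) j.

Definition first_stage (R : realType) (I : nat) (J : 'I_I -> nat)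
    (m : category J -> R) (i : 'I_I) : R :=
  \sum_(j < J i) m (Cat j).

Definition second_stage (R : realType) (I : nat) (J : 'I_I -> nat)
    (m : category J -> R) (i : 'I_I) : 'rV[R]_(J i) :=
  \row_j (m (Cat j) / first_stage m i).

(* For a present survey X and a prior survey Xs of size k: m*_ij is
   (Xs_i / k) * phat_ij, where phat_i is computed from (X_i1, ..., X_iJ_i). *)
Definition mstar (R : realType) (d : measure_display) (T : measurableType d)
    (P : probability T R) (I : nat) (J : 'I_I -> nat)
    (phat : forall i, ('I_(J i) -> nat) -> 'rV[R]_(J i))
    (X : category J -> {RV P >-> nat}) (k : nat) (Xs : 'I_I -> {RV P >-> nat})
    (t : T) (c : category J) : R :=
  (Xs (tag c) t)%:R / k%:R
  * phat (tag c) (fun j => X (Cat j) t) ord0 (tagged c).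

Definition no_empty_cell (R : realType) (d : measure_display)
    (T : measurableType d) (P : probability T R) (I : nat) (J : 'I_I -> nat)
    (X : category J -> {RV P >-> nat}) : set T :=
  [set t | forall i, (\sum_(j < J i) X (Cat j) t)%N <> 0%N].

Definition risk (R : realType) (d : measure_display) (T : measurableType d)
    (P : probability T R) (I : nat) (J : 'I_I -> nat) (m : category J -> R)
    (phat : forall i, ('I_(J i) -> nat) -> 'rV[R]_(J i))
    (X : category J -> {RV P >-> nat}) (k : nat)
    (Xs : 'I_I -> {RV P >-> nat}) : R :=
  cond_expectation P (no_empty_cell X) (fun t => KL (mstar phat X k Xs t) m).

(* f n k = g n k + o(n^-2) + o(k^-2) as n and k tend to infinity *)
Definition eq_up_to_o2 (R : realType) (f g : nat -> nat -> R) : Prop :=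
  exists a b : nat -> R^o,
    [/\ a =o_\oo (fun n => (n%:R ^- 2 : R^o)),
        b =o_\oo (fun k => (k%:R ^- 2 : R^o)) &
        \forall n \near \oo & k \near \oo, f n k = g n k + a n + b k].

(* A is the coefficient of 1/(24 k^2) in the expansion of the risk of the
   estimator phat of p, where Z k is the sample of (non-random) size k. *)
Definition second_order_coef (R : realType) (d : measure_display)
    (T : measurableType d) (P : probability T R) (J s : nat) (p : 'rV[R]_J)
    (phat : ('I_J -> nat) -> 'rV[R]_J) (Z : nat -> 'I_J -> {RV P >-> nat})
    (A : R) : Prop :=
  (fun k => (fine 'E_P[fun t => KL (phat (fun j => Z k j t) ord0) (p ord0)]
             - (s%:R / (2 * k%:R) + A / (24 * k%:R ^+ 2)) : R^o))
  =o_\oo (fun k => (k%:R ^- 2 : R^o)).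

(* Main.v *)
Require Import Defs.
From HB Require Import structures.
From mathcomp Require Import all_boot all_order all_algebra.
From mathcomp Require Import all_classical all_reals all_analysis.
From mathcomp Require Import ring lra.

Set Implicit Arguments.
Unset Strict Implicit.
Unset Printing Implicit Defensive.

Import Order.TTheory GRing.Theory Num.Theory.
Import numFieldNormedType.Exports.

Local Open Scope classical_set_scope.
Local Open Scope ring_scope.

(** Given the present survey, the divergence satisfies a chain rule
    (KL_two_stage): it is the divergence of the first-stage frequencies from
    m_f plus the second-stage divergences weighted by the first-stage
    frequencies. As the prior survey is independent of the present one and its
    frequencies are unbiased, the risk splits (risk_formula) into a function of
    the prior sample size alone, E D[X*/n* : m_f], and a function of n alone,
    the sum over i of m_i. times the mean divergence of the i-th second-stage
    estimator. The two error terms of the claim are the remainders of these two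
    functions.

    The prior part is the risk of the empirical distribution
    (empirical_KL_expansion). Each cell contributes q E[x ln x] with
    x = B / (n q) and B binomial; x ln x is a polynomial in u = x - 1 up to
    O(u^6), uniformly on x >= 0 (xlnx_taylor5_le), and the central moments of
    the binomial law are known exactly (central_moments).

    For the present part, X_i. is binomial with parameter m_i., and given
    X_i. = N the counts inside C_i. form a multinomial sample of size N
    (mexp_lump). Hence the mean divergence is E[g(B); B > 0], where g(N) is the
    risk for the fixed sample size N, and
    g(N) = a / N + b / N^2 + o(N^-2) with a = s_i / 2 and b = A_i / 24.
    Inverse moments of the binomial law turn this into
    a / (n q) + (b + a (1 - q)) / (n q)^2 + o(n^-2) (bexp_expansion), whence the
    correction 12 (1 - m_i.) s_i. Conditioning on the absence of empty cells
    costs only O(n^-3), because the divergences are bounded (KL_bounded) and an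
    empty cell has probability O(n^-3) (bexp_zero_le).

    For full models the estimator is the empirical distribution (full_MLE), so
    the coefficient A_i is itself given by empirical_KL_expansion.

    All expectations are reduced to finite sums first
    (independent_multinomial_expectation). *)

(** * Multinomial expectations *)

Section MultinomialExpectation.
Variable (R : realType).
Implicit Types (K : finType).

Definition add_one K (x : K -> nat) (a : K) : K -> nat :=
  fun b => (x b + (b == a))%N.

(** The expectation of F under the multinomial law, computed by conditioning on
    the category of one draw. The recursion makes lumping of categories and
    binomial marginals immediate inductions; mexp_indicator ties it to the
    probability mass function. *)
Fixpoint mexp K (q : K -> R) (n : nat) (F : (K -> nat) -> R) : R :=
  if n is k.+1 then \sum_a q a * mexp q k (fun x => F (add_one x a))
  else F (fun=> 0%N).

Lemma sum_add_one K (x : K -> nat) a :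
  (\sum_b add_one x a b = (\sum_b x b).+1)%N.
Proof.
rewrite /add_one big_split /= (bigD1 a (F := fun b => nat_of_bool _)) //= eqxx.
by rewrite (big1 _ (fun b => b != a)) ?addn0 ?addn1 // => b /negPf ->.
Qed.

Lemma eq_mexp K (q : K -> R) n F G :
  (forall x, (\sum_a x a)%N = n -> F x = G x) -> mexp q n F = mexp q n G.
Proof.
elim: n F G => [|n IH] F G FG /=; first by apply: FG; rewrite big1.
apply: eq_bigr => a _; congr (_ * _); apply: IH => x xn.
by apply: FG; rewrite sum_add_one xn.
Qed.

Lemma mexpD K (q : K -> R) n F G :
  mexp q n (fun x => F x + G x) = mexp q n F + mexp q n G.
Proof.
elim: n F G => [//|n IH] F G /=.
by rewrite -big_split /=; apply: eq_bigr => a _; rewrite IH mulrDr.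
Qed.

Lemma mexpZ K (q : K -> R) n c F :
  mexp q n (fun x => c * F x) = c * mexp q n F.
Proof.
elim: n F => [//|n IH] F /=.
by rewrite mulr_sumr; apply: eq_bigr => a _; rewrite IH mulrCA.
Qed.

Lemma mexp0 K (q : K -> R) n : mexp q n (fun=> 0) = 0.
Proof. by have := mexpZ q n 0 (fun=> 0); rewrite !mul0r. Qed.

Lemma mexpB K (q : K -> R) n F G :
  mexp q n (fun x => F x - G x) = mexp q n F - mexp q n G.
Proof.
have -> : (fun x => F x - G x) = (fun x => F x + (-1) * G x).
  by apply/funext => x; rewrite mulN1r.
by rewrite mexpD mexpZ mulN1r.
Qed.

Lemma mexp_sum K (q : K -> R) n (I : Type) (r : seq I) (F : I -> (K -> nat) -> R) :
  mexp q n (fun x => \sum_(i <- r) F i x) = \sum_(i <- r) mexp q n (F i).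
Proof.
elim: r => [|i r IH].
  by rewrite big_nil -[RHS](mexp0 q n); apply: eq_mexp => x _; rewrite big_nil.
rewrite big_cons -IH -mexpD; apply: eq_mexp => x _; exact: big_cons.
Qed.

Lemma mexp_cst K (q : K -> R) n c : \sum_a q a = 1 -> mexp q n (fun=> c) = c.
Proof.
move=> q1; elim: n => [//|n IH] /=.
by under eq_bigr do rewrite IH; rewrite -mulr_suml q1 mul1r.
Qed.

Lemma ler_mexp K (q : K -> R) n F G : (forall a, 0 <= q a) ->
  (forall x, (\sum_a x a)%N = n -> F x <= G x) -> mexp q n F <= mexp q n G.
Proof.
move=> q0; elim: n F G => [|n IH] F G FG /=; first by apply: FG; rewrite big1.
apply: ler_sum => a _; apply: ler_wpM2l => //; apply: IH => x xn.
by apply: FG; rewrite sum_add_one xn.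
Qed.

Lemma ler_norm_mexp K (q : K -> R) n F G : (forall a, 0 <= q a) ->
  (forall x, (\sum_a x a)%N = n -> `|F x| <= G x) -> `|mexp q n F| <= mexp q n G.
Proof.
move=> q0 FG; rewrite ler_norml; apply/andP; split; last first.
  by apply: ler_mexp => // x /FG; apply: le_trans; exact: ler_norm.
rewrite -mulN1r -mexpZ; apply: ler_mexp => // x /FG.
by rewrite ler_norml mulN1r => /andP[].
Qed.

(** The mass function obeys the recursion of mexp: the term of the category a is
    q a * pmf_n (x - e_a) = x_a / (n + 1) * pmf_(n+1) x, and the x_a sum to
    n + 1. *)
Lemma mexp_indicator K (q : K -> R) n (x : K -> nat) :
  mexp q n (fun y => (`[< y = x >])%:R) = multinomial_pmf n q x.
Proof.
elim: n x => [|n IH] x.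
  rewrite /= /multinomial_pmf; case: ifPn => [/eqP s0|s0].
    have x0 a : x a = 0%N.
      by apply/eqP; move/eqP: s0; rewrite sum_nat_eq0 => /forallP/(_ a).
    have -> : `[< (fun=> 0%N) = x >] = true.
      by apply/asboolP/funext => a; rewrite x0.
    rewrite (big1 _ _ (fun a => (x a)`!)); last by move=> a _; rewrite x0.
    by rewrite big1 ?mulr1 ?divr1 // => a _; rewrite x0 expr0.
  rewrite (asboolF (P := _ = x)) // => ?; subst x.
  by rewrite big1 in s0.
rewrite [LHS]/=.
have step a : mexp q n (fun y => (`[< add_one y a = x >])%:R) =
    if (0 < x a)%N then multinomial_pmf n q (fun b => (x b - (b == a))%N) else 0.
  case: ifPn => xa.
    rewrite -IH; apply: eq_mexp => y _; congr ((nat_of_bool _)%:R).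
    apply/asbool_equiv_eq; split.
      by move=> <-; apply/funext => b; rewrite /add_one addnK.
    move=> ->; apply/funext => b; rewrite /add_one subnK //.
    by case: eqP => // ->.
  rewrite -[RHS](mexp0 q n); apply: eq_mexp => y _.
  rewrite (asboolF (P := _ = x)) // => e; move: xa.
  by rewrite -e /add_one eqxx addn1.
under eq_bigr do rewrite step.
rewrite {step}.
have step a : q a * (if (0 < x a)%N then
      multinomial_pmf n q (fun b => (x b - (b == a))%N) else 0) =
    (x a)%:R / n.+1%:R * multinomial_pmf n.+1 q x.
  case: ifPn => [xa|]; last first.
    by rewrite -eqn0Ngt => /eqP ->; rewrite mulr0 !mul0r.
  have sx : (\sum_b x b = (\sum_b (x b - (b == a))).+1)%N.
    rewrite (bigD1 a) //= (bigD1 a (F := fun b => (x b - _)%N)) //= eqxx subn1.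
    rewrite -addSn prednK //; congr (_ + _)%N.
    by apply: eq_bigr => b /negPf ->; rewrite subn0.
  rewrite /multinomial_pmf sx eqSS; case: ifPn => _; last by rewrite !mulr0.
  set A := (\prod_(b | b != a) (x b)`!)%N.
  set B := \prod_(b | b != a) q b ^+ x b.
  have -> : (\prod_b (x b - (b == a))`! = (x a).-1`! * A)%N.
    rewrite (bigD1 a) //= eqxx subn1; congr (_ * _)%N.
    by apply: eq_bigr => b /negPf ->; rewrite subn0.
  have -> : \prod_b q b ^+ (x b - (b == a)) = q a ^+ (x a).-1 * B.
    rewrite (bigD1 a) //= eqxx subn1; congr (_ * _).
    by apply: eq_bigr => b /negPf ->; rewrite subn0.
  have -> : (\prod_b (x b)`! = (x a)`! * A)%N by rewrite (bigD1 a).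
  have -> : \prod_b q b ^+ x b = q a ^+ x a * B by rewrite (bigD1 a).
  have A0 : A%:R != 0 :> R.
    by rewrite pnatr_eq0 -lt0n prodn_gt0 // => b; rewrite fact_gt0.
  case: (x a) xa => // c _ /=.
  rewrite !factS !natrM exprS.
  have c0 : c`!%:R != 0 :> R by rewrite pnatr_eq0 -lt0n fact_gt0.
  have c1 : c.+1%:R != 0 :> R by rewrite pnatr_eq0.
  have n1 : n.+1%:R != 0 :> R by rewrite pnatr_eq0.
  by field; rewrite A0 c0 !nat1r c1 n1.
under eq_bigr do rewrite step.
rewrite -mulr_suml -mulr_suml -natr_sum.
rewrite /multinomial_pmf; case: ifPn => [/eqP ->|]; last by rewrite mulr0.
by rewrite divff ?mul1r // pnatr_eq0.
Qed.

(** The binomial law is the multinomial law on two categories, which gives it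
    the linearity and monotonicity of mexp. *)
Definition bexp (q : R) (n : nat) (G : nat -> R) : R :=
  mexp (fun b : bool => if b then q else 1 - q) n (fun x => G (x true)).

Lemma bexpS q n G :
  bexp q n.+1 G = q * bexp q n (fun N => G N.+1) + (1 - q) * bexp q n G.
Proof.
rewrite /bexp /= big_bool /=; congr (_ * _ + _ * _); apply: eq_mexp => x _.
  by rewrite /add_one eqxx addn1.
by rewrite /add_one addn0.
Qed.

Lemma sum_codom (K L : finType) (h : L -> K) (F : K -> R) :
  injective h -> \sum_(a in codom h) F a = \sum_l F (h l).
Proof.
move=> injh; rewrite (reindex_omap h (fun a => [pick l | h l == a])) /=.
  apply: eq_bigl => l; rewrite codom_f /=; apply/eqP.
  by case: pickP => [l' /eqP/injh -> //|/(_ l)]; rewrite eqxx.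
move=> a /codomP[l ->]; case: pickP => [l' /eqP/injh -> //|/(_ l)].
by rewrite eqxx.
Qed.

(** The number of draws in the image of h is binomial, and given that number
    they form a multinomial sample for the conditional probabilities. *)
Lemma mexp_lump (K L : finType) (h : L -> K) (q : K -> R) n F :
  injective h -> \sum_a q a = 1 -> \sum_l q (h l) != 0 ->
  mexp q n (fun x => F (x \o h)) =
  bexp (\sum_l q (h l)) n (mexp (fun l => q (h l) / \sum_l q (h l)) ^~ F).
Proof.
move=> injh q1; set r := \sum_l _ => r0; elim: n F => [|n IH] F.
  by rewrite /bexp /=.
rewrite bexpS [LHS]/= (bigID (mem (codom h))) /=; congr (_ + _).
  rewrite (sum_codom _ injh).
  have step l : mexp q n (fun x => F (add_one x (h l) \o h)) =
      mexp q n (fun x => F (add_one (x \o h) l)).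
    apply: eq_mexp => x _; congr F; apply/funext => l'.
    by rewrite /add_one /= inj_eq.
  under eq_bigr => l _ do rewrite step.
  under eq_bigr => l _ do rewrite (IH (fun y => F (add_one y l))).
  rewrite [in RHS]/bexp -mexpZ /=.
  rewrite [LHS](_ : _ = mexp (fun b : bool => if b then r else 1 - r) n
      (fun x => \sum_l q (h l) * mexp (fun l => q (h l) / r) (x true)
            (fun y => F (add_one y l)))); last first.
    by rewrite mexp_sum; apply: eq_bigr => l _; rewrite mexpZ.
  apply: eq_mexp => x _; rewrite mulr_sumr; apply: eq_bigr => l _.
  by rewrite mulrA; congr (_ * _); rewrite mulrCA divff // mulr1.
have rE : r = \sum_(a in codom h) q a. by rewrite (sum_codom _ injh).
have -> : 1 - r = \sum_(a | a \notin codom h) q a.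
  rewrite -q1 [X in X - _](bigID (mem (codom h))) -rE /=.
  by rewrite addrAC subrr add0r.
rewrite -IH mulr_suml.
apply: eq_bigr => a ha; congr (_ * _); apply: eq_mexp => x _; congr F.
apply/funext => l; rewrite /add_one /=; case: eqP => [e|]; last by rewrite addn0.
by move: ha; rewrite -e codom_f.
Qed.

Lemma mexp_coord K (q : K -> R) n a G :
  \sum_a q a = 1 -> mexp q n (fun x => G (x a)) = bexp (q a) n G.
Proof.
move=> q1; elim: n G => [//|n IH] G.
rewrite bexpS /= (bigD1 a) //=; congr (_ * _ + _).
  by rewrite -IH; apply: eq_mexp => x _; rewrite /add_one eqxx addn1.
rewrite (_ : 1 - q a = \sum_(b | b != a) q b); last first.
  by rewrite -q1 (bigD1 a) //= addrAC subrr add0r.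
rewrite -IH mulr_suml; apply: eq_bigr => b ba; congr (_ * _).
by apply: eq_mexp => x _; rewrite /add_one eq_sym (negPf ba) addn0.
Qed.

End MultinomialExpectation.

(** * Central moments of the binomial law *)

Section BinomialMoments.
Variable R : realType.
Implicit Types (q : R) (n : nat).

Lemma bexpD q n F G :
  bexp q n (fun N => F N + G N) = bexp q n F + bexp q n G.
Proof. by rewrite /bexp -mexpD. Qed.

Lemma bexpZ q n c F : bexp q n (fun N => c * F N) = c * bexp q n F.
Proof. by rewrite /bexp -mexpZ. Qed.

Lemma bexpB q n F G :
  bexp q n (fun N => F N - G N) = bexp q n F - bexp q n G.
Proof. by rewrite /bexp -mexpB. Qed.

Lemma bexp_cst q n c : bexp q n (fun=> c) = c.
Proof. by rewrite /bexp mexp_cst // big_bool /= addrC subrK. Qed.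

Lemma eq_bexp q n F G : (forall N, (N <= n)%N -> F N = G N) ->
  bexp q n F = bexp q n G.
Proof.
move=> FG; apply: eq_mexp => x xn; apply: FG.
by rewrite -xn big_bool leq_addr.
Qed.

Lemma ler_bexp q n F G : 0 <= q <= 1 ->
  (forall N, (N <= n)%N -> F N <= G N) -> bexp q n F <= bexp q n G.
Proof.
move=> /andP[q0 q1] FG; apply: ler_mexp => [[]|x xn]; rewrite ?subr_ge0 //.
by apply: FG; rewrite -xn big_bool leq_addr.
Qed.

Lemma ler_norm_bexp q n F G : 0 <= q <= 1 ->
  (forall N, (N <= n)%N -> `|F N| <= G N) -> `|bexp q n F| <= bexp q n G.
Proof.
move=> /andP[q0 q1] FG; apply: ler_norm_mexp => [[]|x xn]; rewrite ?subr_ge0 //.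
by apply: FG; rewrite -xn big_bool leq_addr.
Qed.

Definition central_moment q n r : R :=
  bexp q n (fun N => (N%:R - n%:R * q) ^+ r).

Lemma central_momentS q n r : central_moment q n.+1 r =
  \sum_(s < r.+1) ('C(r, s))%:R *
    (q * (1 - q) ^+ s + (1 - q) * (- q) ^+ s) * central_moment q n (r - s).
Proof.
have expand c : bexp q n (fun N => (N%:R - n%:R * q + c) ^+ r) =
    \sum_(s < r.+1) ('C(r, s))%:R * c ^+ s * central_moment q n (r - s).
  rewrite (_ : (fun N => _) = (fun N => \sum_(s < r.+1)
      ('C(r, s))%:R * c ^+ s * (N%:R - n%:R * q) ^+ (r - s))); last first.
    apply/funext => N; rewrite exprDn; apply: eq_bigr => s _.
    by rewrite -mulr_natl mulrCA mulrC.
  by rewrite /bexp mexp_sum; apply: eq_bigr => s _; rewrite mexpZ.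
rewrite /central_moment bexpS.
rewrite (_ : (fun N => (N.+1%:R - _) ^+ r) =
   fun N => (N%:R - n%:R * q + (1 - q)) ^+ r); last first.
  by apply/funext => N; congr (_ ^+ _); rewrite -!natr1; ring.
rewrite (_ : (fun N => (N%:R - n.+1%:R * q) ^+ r) =
   fun N => (N%:R - n%:R * q + (- q)) ^+ r); last first.
  by apply/funext => N; congr (_ ^+ _); rewrite -!natr1; ring.
rewrite !expand !mulr_sumr -big_split /=; apply: eq_bigr => s _.
by rewrite /central_moment; ring.
Qed.

(** Order 6 is needed because the Taylor polynomial of x ln x used below has an
    error of order 6; all the forms follow from central_momentS by induction
    on n. *)
Lemma central_moments q n : let v := q * (1 - q) in let N : R := n%:R in
  [/\ central_moment q n 0 = 1, central_moment q n 1 = 0,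
      central_moment q n 2 = N * v &
      central_moment q n 3 = N * v * (1 - 2 * q)] /\
  [/\ central_moment q n 4 = 3 * N ^+ 2 * v ^+ 2 + N * v * (1 - 6 * v),
      central_moment q n 5 = N * v * (1 - 2 * q) * (1 + (10 * N - 12) * v) &
      central_moment q n 6 = N * v * (1 - 30 * v * (1 - 4 * v)
        + 5 * N * v * (5 - 26 * v) + 15 * N ^+ 2 * v ^+ 2)].
Proof.
move=> v; elim: n => [|n [[E0 E1 E2 E3] [E4 E5 E6]]] N.
  by rewrite /central_moment /bexp /= /N; split; split; ring.
have NE : N = n%:R + 1 by rewrite /N natr1.
split; split; rewrite central_momentS !big_ord_recl big_ord0;
  rewrite /bump /= ?subn0 ?subSS ?subn0 /= ?E0 ?E1 ?E2 ?E3 ?E4 ?E5 ?E6 ?NE;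
  rewrite /binomial /= /v; ring.
Qed.

(** The difference of the two sides has derivative (y - 1)^5 / y, so it is
    minimal at 1, where it vanishes. *)
Lemma ln_le_taylor5 (x : R) : 0 < x -> ln x <= (x - 1) - (x - 1) ^+ 2 / 2
   + (x - 1) ^+ 3 / 3 - (x - 1) ^+ 4 / 4 + (x - 1) ^+ 5 / 5.
Proof.
pose T (y : R) := (y - 1) - (y - 1) ^+ 2 / 2
   + (y - 1) ^+ 3 / 3 - (y - 1) ^+ 4 / 4 + (y - 1) ^+ 5 / 5.
pose h (y : R) := T y - ln y.
have dh (y : R) : 0 < y -> is_derive y 1 h ((y - 1) ^+ 5 / y).
  move=> y0.
  have dl := is_derive1_ln y0.
  rewrite /h /T.
  apply: is_derive_eq.
  rewrite /GRing.scale /= ?mulr0 ?subr0 ?mulr1 ?add0r.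
  by field; rewrite gt_eqF.
have h1 : h 1 = 0 by rewrite /h /T ln1; ring.
have dble (a b : R) : 0 <= a -> forall x, x \in `]a, b[ -> derivable h x 1.
  move=> a0 y; rewrite in_itv /= => /andP[ay _].
  by have [] := dh y (le_lt_trans a0 ay).
have ch (a b : R) : 0 < a -> {within `[a, b], continuous h}.
  move=> a0; apply: derivable_within_continuous => y.
  rewrite in_itv /= => /andP[ay _].
  by have [] := dh y (lt_le_trans a0 ay).
move=> x0; rewrite -subr_ge0 -/(h x) -h1.
clearbody h => {T}.
have [x1|/ltW x1] := leP x 1.
  apply: (@ler0_derive1_le_cc _ h x 1) => //; rewrite ?in_itv /= ?lexx ?x1 //.
  - by apply: dble; exact: ltW.
  - move=> y; rewrite in_itv /= => /andP[xy y1].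
    have y0 := lt_trans x0 xy.
    rewrite derive1E; have [_ ->] := dh y y0.
    rewrite pmulr_lle0 ?invr_gt0 // exprn_odd_le0 //; lra.
  - exact: ch.
apply: (@ger0_derive1_le_cc _ h 1 x) => //; rewrite ?in_itv /= ?lexx ?x1 //.
- exact: dble.
- move=> y; rewrite in_itv /= => /andP[xy y1].
  rewrite derive1E; have [_ ->] := dh y (lt_trans ltr01 xy).
  by rewrite divr_ge0 ?exprn_ge0 //; lra.
- exact: ch.
Qed.

End BinomialMoments.

(** * Risk of the empirical distribution *)

Section EmpiricalDivergence.
Variable R : realType.

Lemma ln_le_subr1 (x : R) : 0 < x -> ln x <= x - 1.
Proof.
by move=> x0; have := @le_ln1Dx R (x - 1); rewrite addrCA subrr addr0; apply; lra.
Qed.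

(** The Taylor polynomial of x ln x at x = 1 + u. *)
Definition xlnx_taylor5 (u : R) : R :=
  u + u ^+ 2 / 2 - u ^+ 3 / 6 + u ^+ 4 / 12 - u ^+ 5 / 20.

(** The upper bound is ln_le_taylor5 at x. The lower bound comes from
    ln_le_taylor5 at 1 / x as long as x >= 1 / 2; for smaller x the bound
    x ln x >= x - 1 is enough, u^6 being bounded below there. *)
Lemma xlnx_taylor5_le (x : R) : 0 <= x ->
  `|x * ln x - xlnx_taylor5 (x - 1)| <= 16 * (x - 1) ^+ 6.
Proof.
move=> x0; rewrite /xlnx_taylor5.
have up : x * ln x <= x * ((x - 1) - (x - 1) ^+ 2 / 2
   + (x - 1) ^+ 3 / 3 - (x - 1) ^+ 4 / 4 + (x - 1) ^+ 5 / 5).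
  move: x0; rewrite le_eqVlt => /predU1P[<-|x0]; first by rewrite !mul0r.
  by apply: ler_wpM2l; [exact: ltW | exact: ln_le_taylor5].
have lo1 : x - 1 <= x * ln x.
  move: (x0); rewrite le_eqVlt => /predU1P[<-|xp]; first by rewrite mul0r; lra.
  have := @ln_le_subr1 x^-1; rewrite invr_gt0 lnV ?posrE // => /(_ xp) H.
  have := ler_wpM2l x0 H; rewrite mulrBr mulfV ?gt_eqF //; lra.
have u6 : 0 <= (x - 1) ^+ 6 by rewrite exprn_even_ge0.
rewrite ler_norml; apply/andP; split; last first.
  apply: le_trans (_ : (x - 1) ^+ 6 / 5 <= _); last by lra.
  rewrite lerBlDr; apply: le_trans up _; rewrite le_eqVlt; apply/orP; left.
  by apply/eqP; field.
have [xh|xh] := leP 2^-1 x.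
  have xp : 0 < x by lra.
  have lo : (x - 1) + (x - 1) ^+ 2 / (2 * x) + (x - 1) ^+ 3 / (3 * x ^+ 2)
      + (x - 1) ^+ 4 / (4 * x ^+ 3) + (x - 1) ^+ 5 / (5 * x ^+ 4) <= x * ln x.
    have : 0 < x^-1 by rewrite invr_gt0.
    move=> /ln_le_taylor5; rewrite lnV ?posrE // => H.
    have {}H := ler_wpM2l x0 H; rewrite mulrN in H.
    rewrite -lerN2; apply: le_trans H _; rewrite le_eqVlt; apply/orP; left.
    by apply/eqP; field; rewrite gt_eqF.
  (* The bound lo exceeds the Taylor polynomial by exactly this fraction. *)
  apply: (@le_trans _ _ ((x - 1) ^+ 6 * (-8 + 8 * (x - 1) + 7 * (x - 1) ^+ 2
     + 3 * (x - 1) ^+ 3) / (60 * x ^+ 4))); last first.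
    rewrite lerBrDr; apply: le_trans lo; rewrite le_eqVlt; apply/orP; left.
    by apply/eqP; field; rewrite gt_eqF.
  rewrite -mulNr mulrC -mulrA; apply: ler_wpM2l => //.
  rewrite lerNl -mulNr ler_pdivrMr ?mulr_gt0 ?exprn_gt0 //.
  have x2 : 4^-1 <= x ^+ 2 by rewrite expr2; nra.
  have x4 : 16^-1 <= x ^+ 4 by rewrite (exprM x 2 2) expr2; nra.
  have x3 : 0 <= x ^+ 3 by rewrite exprn_ge0.
  rewrite (_ : -8 + 8 * (x - 1) + 7 * (x - 1) ^+ 2 + 3 * (x - 1) ^+ 3 =
     -12 + 3 * x - 2 * x ^+ 2 + 3 * x ^+ 3); last by ring.
  have x24 : 2 * x ^+ 2 <= 1 + x ^+ 4.
    by rewrite (exprM x 2 2); have := sqr_ge0 (x ^+ 2 - 1); lra.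
  lra.
rewrite lerBrDr; apply: le_trans lo1.
set w := 1 - x; have -> : x - 1 = - w by rewrite /w; ring.
have w1 : 2^-1 <= w by rewrite /w; lra.
have w0 : 0 <= w by lra.
have h k : w ^+ k <= 2 * w ^+ k.+1.
  by rewrite exprS mulrA ler_peMl ?exprn_ge0 //; lra.
have h2 : w ^+ 2 <= 2 * w ^+ 3 := h 2%N.
have h3 : w ^+ 3 <= 2 * w ^+ 4 := h 3%N.
have h4 : w ^+ 4 <= 2 * w ^+ 5 := h 4%N.
have h5 : w ^+ 5 <= 2 * w ^+ 6 := h 5%N.
have h6 : 0 <= w ^+ 6 by exact: exprn_ge0.
rewrite (_ : (- w) ^+ 6 = w ^+ 6); last by ring.
rewrite (_ : _ + _ = w ^+ 2 / 2 + w ^+ 3 / 6 + w ^+ 4 / 12 + w ^+ 5 / 20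
  - w - 16 * w ^+ 6); last by ring.
lra.
Qed.

(** With u = (B - n q) / (n q), the moments of order 2 to 4 produce the two main
    terms; those of order 5 and 6, which are O(n^2) and O(n^3), only contribute
    O(n^-3). *)
Lemma binomial_xlnx_expansion (q : R) : 0 < q <= 1 ->
  exists C, forall n, (0 < n)%N ->
  `|bexp q n (fun N => N%:R / n%:R * ln (N%:R / n%:R / q))
    - ((1 - q) / (2 * n%:R) + (q^-1 - q) / (12 * n%:R ^+ 2))| <= C / n%:R ^+ 3.
Proof.
move=> /andP[q0 q1].
exists (7 / 12 / q ^+ 2 + 23 / 20 / q ^+ 3 + 16 * 161 / q ^+ 5) => n n0.
set N : R := n%:R.
have N1 : 1 <= N by rewrite /N ler1n.
have N0 : 0 < N by lra.
have q01 : 0 <= q <= 1 by rewrite ltW.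
pose u k : R := (k%:R - N * q) / (N * q).
have xE k : k%:R / N / q = u k + 1.
  by rewrite /u; field; rewrite !gt_eqF.
have [[E0 E1 E2 E3] [E4 E5 E6]] := central_moments q n.
set v := q * (1 - q) in E2 E3 E4 E5 E6.
rewrite -/N in E2 E3 E4 E5 E6.
have v01 : 0 <= v <= 1 by rewrite /v; apply/andP; split; nra.
have bexpu r : bexp q n (fun k => u k ^+ r) = central_moment q n r / (N * q) ^+ r.
  rewrite mulrC -bexpZ; apply: eq_bexp => k _.
  by rewrite /u expr_div_n mulrC.
have main : bexp q n (fun k => q * xlnx_taylor5 (u k)) =
   q * (central_moment q n 1 / (N * q) + central_moment q n 2 / (2 * (N * q) ^+ 2)
     - central_moment q n 3 / (6 * (N * q) ^+ 3)
     + central_moment q n 4 / (12 * (N * q) ^+ 4)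
     - central_moment q n 5 / (20 * (N * q) ^+ 5)).
  rewrite bexpZ; congr (_ * _).
  rewrite (_ : (fun k => xlnx_taylor5 (u k)) = fun k => u k ^+ 1 + (2^-1 * u k ^+ 2 +
    ((- 6^-1) * u k ^+ 3 + (12^-1 * u k ^+ 4 + (-20^-1) * u k ^+ 5)))); last first.
    by apply/funext => k; rewrite /= /xlnx_taylor5; ring.
  rewrite !(bexpD, bexpZ) !bexpu; field; rewrite !gt_eqF //.
rewrite (_ : bexp _ _ _ - _ = bexp q n (fun k => q * ((u k + 1) * ln (u k + 1)
    - xlnx_taylor5 (u k))) + (bexp q n (fun k => q * xlnx_taylor5 (u k))
    - ((1 - q) / (2 * N) + (q^-1 - q) / (12 * N ^+ 2)))); last first.
  rewrite addrA; congr (_ - _); rewrite -bexpD; apply: eq_bexp => k _.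
  by rewrite xE -mulrDr subrK mulrA; congr (_ * _); rewrite -xE; field; rewrite !gt_eqF.
have err : `|bexp q n (fun k => q * ((u k + 1) * ln (u k + 1)
    - xlnx_taylor5 (u k)))| <= 16 * 161 / q ^+ 5 / N ^+ 3.
  apply: (@le_trans _ _ (16 * q * (central_moment q n 6 / (N * q) ^+ 6))).
    rewrite -bexpu -bexpZ; apply: ler_norm_bexp => // k _.
    rewrite normrM gtr0_norm // -mulrA mulrCA; apply: ler_wpM2l; first exact: ltW.
    have := @xlnx_taylor5_le (u k + 1); rewrite addrK; apply.
    by rewrite -xE !divr_ge0 // ltW.
  rewrite (exprMn 6 N q) E6 (_ : _ / q ^+ 5 / N ^+ 3 =
      16 * q * (161 * N ^+ 3 / (N ^+ 6 * q ^+ 6))); last first.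
    by field; rewrite !gt_eqF.
  apply: ler_wpM2l; first by lra.
  rewrite ler_pM2r ?invr_gt0 ?mulr_gt0 ?exprn_gt0 //.
  have v2 : v ^+ 2 <= 1 by rewrite expr2; nra.
  have N2 : N <= N ^+ 2 by rewrite expr2; nra.
  have N2v : N ^+ 2 * v ^+ 2 <= N ^+ 2 by rewrite ler_piMr // exprn_ge0 // ltW.
  have Nv : N * v <= N by nra.
  have Nv0 : 0 <= N * v by nra.
  have Nvv : 0 <= N * v * v by nra.
  rewrite (_ : 161 * N ^+ 3 = N * (161 * N ^+ 2)); last by ring.
  apply: (@le_trans _ _ (N * v * (161 * N ^+ 2))); last first.
    by apply: ler_wpM2r => //; rewrite mulr_ge0 ?exprn_ge0 // ltW.
  by apply: ler_wpM2l => //; nra.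
rewrite (_ : (_ + _) / N ^+ 3 = 16 * 161 / q ^+ 5 / N ^+ 3 +
  (7 / 12 / q ^+ 2 / N ^+ 3 + 23 / 20 / q ^+ 3 / N ^+ 3)); last by ring.
apply: le_trans (ler_normD _ _) _; apply: lerD err _.
rewrite main E1 E2 E3 E4 E5.
rewrite (_ : _ - _ = (1 - q) * (1 - 6 * v) / 12 / q ^+ 2 / N ^+ 3
   - (1 - q) * (1 - 2 * q) * ((1 + (10 * N - 12) * v) / N) / 20 / q ^+ 3 / N ^+ 3);
  last by rewrite /v; field; rewrite !gt_eqF.
have q2 : 0 <= (q ^+ 2)^-1 / N ^+ 3.
  by rewrite mulr_ge0 // invr_ge0 exprn_ge0 // ltW.
have q3 : 0 <= (q ^+ 3)^-1 / N ^+ 3.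
  by rewrite mulr_ge0 // invr_ge0 exprn_ge0 // ltW.
have iN : 0 < N^-1 <= 1 by rewrite invr_gt0 N0 invf_le1.
rewrite (_ : (1 + (10 * N - 12) * v) / N = N^-1 * (1 - 12 * v) + 10 * v); last first.
  by field; rewrite gt_eqF.
set w := N^-1 * (1 - 12 * v) + 10 * v.
have w23 : -23 <= w <= 23 by rewrite /w; apply/andP; split; nra.
have a7 : -7 <= (1 - q) * (1 - 6 * v) <= 7 by apply/andP; split; nra.
have b1 : -1 <= (1 - q) * (1 - 2 * q) <= 1 by apply/andP; split; nra.
have b23 : -23 <= (1 - q) * (1 - 2 * q) * w <= 23 by apply/andP; split; nra.
move: q2 q3; set Q2 := _ / _; set Q3 := _ / _ => q2 q3.
rewrite (_ : _ - _ = (1 - q) * (1 - 6 * v) * Q2 / 12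
  - (1 - q) * (1 - 2 * q) * w * Q3 / 20); last by rewrite /Q2 /Q3; ring.
rewrite (_ : _ + _ = 7 * Q2 / 12 + 23 * Q3 / 20); last by rewrite /Q2 /Q3; ring.
have [/andP[a7l a7r] /andP[b23l b23r]] := (a7, b23).
have Al := ler_wpM2r q2 a7l; have Ar := ler_wpM2r q2 a7r.
have Bl := ler_wpM2r q3 b23l; have Br := ler_wpM2r q3 b23r.
rewrite ler_norml; apply/andP; split; lra.
Qed.

Definition o2 (a : nat -> R) : Prop :=
  forall e, 0 < e -> \forall n \near \oo, `|a n| <= e / n%:R ^+ 2.

Lemma o2P (a : nat -> R^o) : o2 a <-> a =o_\oo (fun n => (n%:R ^- 2 : R^o)).
Proof.
have E (e : R) (n : nat) : e * `|n%:R ^- 2 : R^o| = e / n%:R ^+ 2.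
  by rewrite ger0_norm // invr_ge0 exprn_ge0.
split=> [ao|/eqoP ao].
  apply/eqoP => e e0; have := ao e e0; apply: filterS => n.
  by rewrite E.
by move=> e e0; have := ao e e0; apply: filterS => n; rewrite E.
Qed.

Lemma o2D a b : o2 a -> o2 b -> o2 (fun n => a n + b n).
Proof.
move=> ao bo e e0; have e2 : 0 < e / 2 by rewrite divr_gt0.
apply: filterS2 (ao _ e2) (bo _ e2) => n an bn.
apply: le_trans (ler_normD _ _) _; apply: le_trans (lerD an bn) _.
by rewrite -mulrDl -splitr.
Qed.

Lemma o2Z c a : o2 a -> o2 (fun n => c * a n).
Proof.
move=> ao e e0; have c0 : 0 < `|c| + 1 by rewrite ltr_wpDl.
apply: filterS (ao _ (divr_gt0 e0 c0)) => n an.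
rewrite normrM; apply: (@le_trans _ _ ((`|c| + 1) * `|a n|)).
  by apply: ler_wpM2r => //; rewrite lerDl.
rewrite mulrC -ler_pdivlMr //; apply: le_trans an _.
by rewrite mulrAC.
Qed.

Lemma o2_sum (K : finType) (a : K -> nat -> R) :
  (forall i, o2 (a i)) -> o2 (fun n => \sum_i a i n).
Proof.
move=> ao; elim: (index_enum K) => [|i r IH] e e0.
  apply: nearW => n; rewrite big_nil normr0 mulr_ge0 ?invr_ge0 ?exprn_ge0 //.
  exact: ltW.
have := o2D (ao i) IH e0; apply: filterS => n.
by rewrite big_cons.
Qed.

Lemma near_n_gt0 : \forall n \near \oo, (0 < n)%N.
Proof. by exists 1%N. Qed.

Lemma o2_near a b : (\forall n \near \oo, a n = b n) -> o2 a -> o2 b.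
Proof.
move=> ab ao e e0; apply: filterS2 ab (ao _ e0) => n -> //.
Qed.

Lemma o2_cubic a C :
  (\forall n \near \oo, `|a n| <= C / n%:R ^+ 3) -> o2 a.
Proof.
move=> aC e e0.
apply: filterS3 aC near_n_gt0 (nbhs_infty_gtr (C / e)) => n an n0 nC.
have n0R : 0 < n%:R :> R by rewrite ltr0n.
apply: le_trans an _; rewrite exprS invfM mulrA.
rewrite ler_wpM2r ?invr_ge0 ?exprn_ge0 //.
by rewrite ler_pdivrMr // mulrC -ler_pdivrMr // ltW.
Qed.

(** The divergence is a sum over the categories of functions of binomial
    counts. *)
Lemma empirical_KL_expansion (K : finType) (q : K -> R) :
  (forall a, 0 < q a) -> \sum_a q a = 1 ->
  o2 (fun n => mexp q n (fun x => KL (fun a => (x a)%:R / n%:R) q)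
    - ((#|K|%:R - 1) / (2 * n%:R)
       + (\sum_a (q a)^-1 - 1) / (12 * n%:R ^+ 2))).
Proof.
move=> q0 q1.
have qle a : 0 < q a <= 1.
  by rewrite q0 /= -q1 (bigD1 a) //= lerDl sumr_ge0 // => b _; exact: ltW.
have := o2_sum (a := fun a n =>
  bexp (q a) n (fun N => N%:R / n%:R * ln (N%:R / n%:R / q a))
    - ((1 - q a) / (2 * n%:R) + ((q a)^-1 - q a) / (12 * n%:R ^+ 2))) _.
move=> H; apply: o2_near (H _); last first.
  move=> a; have [C hC] := binomial_xlnx_expansion (qle a).
  by apply: (o2_cubic (C := C)); apply: filterS near_n_gt0; exact: hC.
apply: nearW => n; rewrite sumrB big_split /= -!mulr_suml !sumrB q1.
rewrite sumr_const; congr (_ - _).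
by rewrite /KL mexp_sum; apply: eq_bigr => a _; rewrite -(mexp_coord n a).
Qed.

End EmpiricalDivergence.

(** * Inverse moments of the binomial law *)

Section InverseMoments.
Variables (R : realType) (q : R).
Hypothesis q01 : 0 < q <= 1.

Let q0 : 0 < q. Proof. by case/andP: q01. Qed.
Let q01' : 0 <= q <= 1. Proof. by case/andP: q01 => /ltW ->. Qed.

(** Size biasing: conditioning on a given draw being a success removes that draw
    from the sample. *)
Lemma bexp_size_bias n G : bexp q n (fun N => N%:R * G N) =
  n%:R * q * bexp q n.-1 (fun N => G N.+1).
Proof.
elim: n G => [|n IH] G; first by rewrite /bexp /= !mul0r.
rewrite bexpS -[_.+1.-1]/n.
have -> : bexp q n (fun N => N.+1%:R * G N.+1) =
    bexp q n (fun N => G N.+1) + bexp q n (fun N => N%:R * G N.+1).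
  by rewrite -bexpD; apply: eq_bexp => N _; rewrite -nat1r mulrDl mul1r.
rewrite (IH (fun N => G N.+1)) (IH G); case: n {IH} => [|n]; first by ring.
by rewrite [bexp q n.+1 _]bexpS /= -[n.+2%:R]nat1r; ring.
Qed.

(** Reciprocals of rising factorials: unlike powers of 1 / N, they are carried
    into one another by bexp_size_bias, so that their expectations are known up
    to the probability of the value 0. *)
Definition rising_inv1 (N : nat) : R := N.+1%:R^-1.
Definition rising_inv2 (N : nat) : R := (N.+1%:R * N.+2%:R)^-1.
Definition rising_inv3 (N : nat) : R := (N.+1%:R * N.+2%:R * N.+3%:R)^-1.

Definition zero_indicator (N : nat) : R := if N is 0%N then 1 else 0.

Lemma bexp_rising_inv1 n :
  bexp q n rising_inv1 = (1 - bexp q n.+1 zero_indicator) / (n.+1%:R * q).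
Proof.
have := bexp_size_bias n.+1 (fun N => N%:R^-1).
rewrite -[_.+1.-1]/n -/rising_inv1 => E.
apply: (canRL (mulfK _)); first by rewrite mulf_neq0 // gt_eqF.
rewrite mulrC -E -[X in X - _](bexp_cst q n.+1) -mulN1r -bexpZ -bexpD.
apply: eq_bexp => -[|N] _; rewrite /zero_indicator /=; first by rewrite mul0r; ring.
by rewrite mulfV ?pnatr_eq0 //; ring.
Qed.

Lemma bexp_rising_inv2 n : bexp q n rising_inv2 =
  (bexp q n.+1 rising_inv1 - bexp q n.+1 zero_indicator) / (n.+1%:R * q).
Proof.
have := bexp_size_bias n.+1 (fun N => (N%:R * N.+1%:R)^-1).
rewrite -[_.+1.-1]/n -/rising_inv2 => E.
apply: (canRL (mulfK _)); first by rewrite mulf_neq0 // gt_eqF.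
rewrite mulrC -E -mulN1r -bexpZ -bexpD.
apply: eq_bexp => -[|N] _; rewrite /zero_indicator /rising_inv1 /=.
  by rewrite !mul0r; field.
by rewrite invfM mulrA mulfV ?pnatr_eq0 //; ring.
Qed.

Lemma bexp_rising_inv3 n : bexp q n rising_inv3 =
  (bexp q n.+1 rising_inv2 - 2^-1 * bexp q n.+1 zero_indicator) / (n.+1%:R * q).
Proof.
have := bexp_size_bias n.+1 (fun N => (N%:R * N.+1%:R * N.+2%:R)^-1).
rewrite -[_.+1.-1]/n -/rising_inv3 => E.
apply: (canRL (mulfK _)); first by rewrite mulf_neq0 // gt_eqF.
rewrite mulrC -E -mulNr -bexpZ -bexpD.
apply: eq_bexp => -[|N] _; rewrite /zero_indicator /rising_inv2 /=.
  by rewrite !mul0r; field.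
by rewrite -mulrA invfM mulrA mulfV ?pnatr_eq0 //; ring.
Qed.

Lemma bexp_zero_ge0 n : 0 <= bexp q n zero_indicator.
Proof.
rewrite -[X in X <= _](bexp_cst q n); apply: ler_bexp => // -[|N] _; by rewrite /zero_indicator ?ler01.
Qed.

Let n1q n : 0 < n.+1%:R * q. Proof. by rewrite mulr_gt0. Qed.

Lemma bexp_rising_inv1_le n : bexp q n rising_inv1 <= (n.+1%:R * q)^-1.
Proof.
rewrite bexp_rising_inv1 -[leRHS]mul1r; apply: ler_wpM2r.
  by rewrite invr_ge0 ltW.
by rewrite gerBl bexp_zero_ge0.
Qed.

Lemma bexp_rising_inv2_le n :
  bexp q n rising_inv2 <= (n.+2%:R * q)^-1 * (n.+1%:R * q)^-1.
Proof.
rewrite bexp_rising_inv2; apply: ler_wpM2r.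
  by rewrite invr_ge0 ltW.
apply: le_trans (bexp_rising_inv1_le _).
by rewrite gerBl bexp_zero_ge0.
Qed.

Lemma bexp_rising_inv2_le_sqr n : (0 < n)%N ->
  bexp q n rising_inv2 <= (q ^+ 2)^-1 / n%:R ^+ 2.
Proof.
move=> n0; apply: le_trans (bexp_rising_inv2_le n) _.
have n0R : 0 < n%:R :> R by rewrite ltr0n.
rewrite !invfM mulrACA -expr2 exprVn mulrC; apply: ler_wpM2l.
  by rewrite invr_ge0 exprn_ge0 // ltW.
apply: ler_pM; rewrite ?invr_ge0 ?ler0n //;
  by rewrite lef_pV2 ?posrE ?ltr0n // ler_nat // leqW.
Qed.

Lemma bexp_rising_inv3_le n : (0 < n)%N ->
  bexp q n rising_inv3 <= (q ^+ 3)^-1 / n%:R ^+ 3.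
Proof.
move=> n0; have n0R : 0 < n%:R :> R by rewrite ltr0n.
rewrite bexp_rising_inv3; apply: (@le_trans _ _ ((q ^+ 2)^-1 / n%:R ^+ 2 / (n%:R * q))).
  apply: (@le_trans _ _ ((q ^+ 2)^-1 / n%:R ^+ 2 / (n.+1%:R * q))).
    apply: ler_wpM2r; first by rewrite invr_ge0 ltW.
    apply: (@le_trans _ _ (bexp q n.+1 rising_inv2)).
      by rewrite gerBl mulr_ge0 // bexp_zero_ge0.
    apply: le_trans (bexp_rising_inv2_le_sqr _) _ => //.
    apply: ler_wpM2l; first by rewrite invr_ge0 exprn_ge0 // ltW.
    by rewrite lef_pV2 ?posrE ?exprn_gt0 ?ltr0n // lerXn2r ?nnegrE // ler_nat.
  apply: ler_wpM2l; first by rewrite mulr_ge0 // invr_ge0 exprn_ge0 // ltW.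
  by rewrite lef_pV2 ?posrE ?mulr_gt0 // ler_pM2r // ler_nat.
by rewrite le_eqVlt; apply/orP; left; apply/eqP; field; rewrite !gt_eqF.
Qed.

Lemma rising_inv3_gt0 N : 0 < rising_inv3 N.
Proof. by rewrite invr_gt0 !mulr_gt0. Qed.

(** This probability is in fact (1 - q)^n; the cubic rate suffices and follows
    from comparing the indicator with rising_inv3. *)
Lemma bexp_zero_le n : (0 < n)%N -> bexp q n zero_indicator <= 6 / q ^+ 3 / n%:R ^+ 3.
Proof.
move=> n0; rewrite -!mulrA; apply: (@le_trans _ _ (6 * bexp q n rising_inv3)).
  rewrite -bexpZ; apply: ler_bexp => // -[|N] _; rewrite /zero_indicator /=.
    by rewrite /rising_inv3; lra.
  by rewrite mulr_ge0 // ltW // rising_inv3_gt0.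
by apply: ler_wpM2l => //; exact: bexp_rising_inv3_le.
Qed.


Lemma bexp_zeroS_le n j : (0 < n)%N ->
  bexp q (n + j) zero_indicator <= 6 / q ^+ 3 / n%:R ^+ 3.
Proof.
move=> n0; apply: le_trans (bexp_zero_le _) _; first by rewrite addn_gt0 n0.
apply: ler_wpM2l; first by rewrite divr_ge0 // exprn_ge0 // ltW.
rewrite lef_pV2 ?posrE ?exprn_gt0 ?ltr0n ?addn_gt0 ?n0 //.
by rewrite lerXn2r ?nnegrE // ler_nat leq_addr.
Qed.

Let invn1q n : 0 < (n.+1%:R * q)^-1 <= q^-1.
Proof.
rewrite invr_gt0 n1q /= lef_pV2 ?posrE //.
by rewrite ler_peMl ?ler1n // ltW.
Qed.

Lemma bexp_rising_inv1_approx n : (0 < n)%N ->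
  `|bexp q n rising_inv1 - (n.+1%:R * q)^-1| <= 6 / q ^+ 4 / n%:R ^+ 3.
Proof.
move=> n0; have P1 := bexp_zeroS_le 1 n0; rewrite addn1 in P1.
have P0 := bexp_zero_ge0 n.+1; have /andP[i0 i1] := invn1q n.
rewrite bexp_rising_inv1 mulrBl mul1r addrAC subrr add0r normrN ger0_norm; last first.
  by rewrite mulr_ge0 // ltW.
apply: (@le_trans _ _ (6 / q ^+ 3 / n%:R ^+ 3 * q^-1)).
  by apply: ler_pM => //; exact: ltW.
rewrite le_eqVlt; apply/orP; left; apply/eqP; field.
by rewrite !gt_eqF // ltr0n.
Qed.

Lemma bexp_rising_inv2_approx n : (0 < n)%N ->
  `|bexp q n rising_inv2 - (n.+2%:R * q)^-1 * (n.+1%:R * q)^-1|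
    <= (6 / q ^+ 5 + 6 / q ^+ 4) / n%:R ^+ 3.
Proof.
move=> n0; have P1 := bexp_zeroS_le 1 n0; rewrite addn1 in P1.
have P0 := bexp_zero_ge0 n.+1; have /andP[i0 i1] := invn1q n.
rewrite bexp_rising_inv2 -mulrBl addrAC normrM (gtr0_norm i0).
apply: (@le_trans _ _ ((6 / q ^+ 4 / n%:R ^+ 3 + 6 / q ^+ 3 / n%:R ^+ 3) * q^-1)).
  apply: ler_pM => //; first exact: ltW.
  apply: le_trans (ler_normB _ _) _; apply: lerD; last by rewrite ger0_norm.
  apply: le_trans (bexp_rising_inv1_approx _) _ => //.
  apply: ler_wpM2l; first by rewrite divr_ge0 // exprn_ge0 // ltW.
  by rewrite lef_pV2 ?posrE ?exprn_gt0 ?ltr0n // lerXn2r ?nnegrE // ler_nat.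
rewrite le_eqVlt; apply/orP; left; apply/eqP; field.
by rewrite !gt_eqF // ltr0n.
Qed.

Let inv_shift1 n : (0 < n)%N ->
  `|n.+1%:R^-1 - (n%:R^-1 - n%:R ^- 2)| <= n%:R ^- 3 :> R.
Proof.
move=> n0; have n0R : 0 < n%:R :> R by rewrite ltr0n.
rewrite -natr1 (_ : _ - _ = ((n%:R + 1) * n%:R ^+ 2)^-1); last first.
  by field; rewrite !gt_eqF // ltr_wpDl // ltW.
rewrite ger0_norm; last by rewrite invr_ge0 mulr_ge0 // exprn_ge0 // ltW.
have n1 : 0 < n%:R + 1 :> R by rewrite ltr_wpDl // ltW.
rewrite lef_pV2 ?posrE ?mulr_gt0 ?exprn_gt0 //.
by rewrite [leLHS]exprS; apply: ler_wpM2r; rewrite ?exprn_ge0 ?lerDl // ltW.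
Qed.

Let inv_shift2 n : (0 < n)%N ->
  `|n.+2%:R^-1 * n.+1%:R^-1 - n%:R ^- 2| <= 3 * n%:R ^- 3 :> R.
Proof.
move=> n0; have n0R : 0 < n%:R :> R by rewrite ltr0n.
have n1 : 0 < n%:R + 1 :> R by rewrite ltr_wpDl // ltW.
have n2 : 0 < n%:R + 1 + 1 :> R by rewrite ltr_wpDl // ltW.
rewrite -(natr1 n.+1) -(natr1 n) (_ : _ - _ = - ((3 * n%:R + 2) / (n%:R ^+ 2
   * ((n%:R + 1) * (n%:R + 1 + 1))))); last by field; rewrite !gt_eqF.
rewrite normrN ger0_norm; last first.
  by rewrite divr_ge0 ?mulr_ge0 ?exprn_ge0 //; lra.
rewrite ler_pdivrMr ?mulr_gt0 ?exprn_gt0 //.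
rewrite [leRHS](_ : _ = 3 * ((n%:R + 1) * (n%:R + 1 + 1)) / n%:R); last first.
  by field; rewrite gt_eqF.
by rewrite ler_pdivlMr //; nra.
Qed.

(** As 0^-1 = 0 here, this is E[1/B; B > 0]. It follows from
    1 / N = 1 / (N + 1) + 1 / ((N + 1) (N + 2)) + O(rising_inv3 N); the constant 9
    also covers N = 0, where the error is 3 / 2 = 9 / 6. *)
Lemma bexp_inv_expansion : exists C, forall n, (0 < n)%N ->
  `|bexp q n (fun N => N%:R^-1) - (n%:R^-1 / q + (1 - q) / q ^+ 2 / n%:R ^+ 2)|
    <= C / n%:R ^+ 3.
Proof.
exists (9 / q ^+ 3 + 6 / q ^+ 4 + (6 / q ^+ 5 + 6 / q ^+ 4) + q^-1
  + 3 / q ^+ 2) => n n0.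
have n0R : 0 < n%:R :> R by rewrite ltr0n.
have h1 : `|bexp q n (fun N => N%:R^-1 - (rising_inv1 N + rising_inv2 N))|
    <= 9 / q ^+ 3 / n%:R ^+ 3.
  apply: (@le_trans _ _ (9 * bexp q n rising_inv3)); last first.
    by rewrite -mulrA; apply: ler_wpM2l => //; exact: bexp_rising_inv3_le.
  rewrite -bexpZ; apply: ler_norm_bexp => // -[|N] _.
    by rewrite /rising_inv1 /rising_inv2 /rising_inv3 invr0 ler_norml; lra.
  rewrite /rising_inv1 /rising_inv2 /rising_inv3.
  rewrite -(natr1 N.+3) -(natr1 N.+2) -(natr1 N.+1) -(natr1 N).
  have : 0 <= N%:R :> R by [].
  set M : R := N%:R => M0.
  have M1 : 0 < M + 1 by lra.
  have M2 : 0 < M + 1 + 1 by lra.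
  have M3 : 0 < M + 1 + 1 + 1 by lra.
  have M4 : 0 < M + 1 + 1 + 1 + 1 by lra.
  rewrite (_ : _ - _ = 2 / ((M + 1) * (M + 1 + 1) * (M + 1 + 1 + 1))); last first.
    by field; rewrite !gt_eqF.
  have D0 : 0 < (M + 1) * (M + 1 + 1) * (M + 1 + 1 + 1) by rewrite !mulr_gt0.
  rewrite ger0_norm; last by rewrite divr_ge0 // ltW.
  rewrite ler_pdivrMr ?mulr_gt0 // [leRHS](_ : _ = 9 * (M + 1) / (M + 1 + 1 + 1 + 1)).
    by rewrite ler_pdivlMr //; lra.
  by field; rewrite !gt_eqF.
have h2 := bexp_rising_inv1_approx n0; have h3 := bexp_rising_inv2_approx n0.
have h4 := inv_shift1 n0; have h5 := inv_shift2 n0.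
rewrite bexpB bexpD in h1.
have qi : 0 <= q^-1 by rewrite invr_ge0 ltW.
have {}h4 := ler_wpM2l qi h4; rewrite -[X in X * _ <= _](ger0_norm qi) -normrM in h4.
have q2i : 0 <= q ^- 2 by rewrite invr_ge0 exprn_ge0 // ltW.
have {}h5 := ler_wpM2l q2i h5; rewrite -[X in X * _ <= _](ger0_norm q2i) -normrM in h5.
rewrite [leRHS](_ : _ = 9 / q ^+ 3 / n%:R ^+ 3 + (6 / q ^+ 4 / n%:R ^+ 3
  + ((6 / q ^+ 5 + 6 / q ^+ 4) / n%:R ^+ 3 + (q^-1 * n%:R ^- 3
  + q ^- 2 * (3 * n%:R ^- 3))))); last by ring.
set X := bexp q n (fun N => _^-1); rewrite -/X in h1.
rewrite (_ : X - _ = (X - (bexp q n rising_inv1 + bexp q n rising_inv2)) +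
  ((bexp q n rising_inv1 - (n.+1%:R * q)^-1) +
   ((bexp q n rising_inv2 - (n.+2%:R * q)^-1 * (n.+1%:R * q)^-1) +
   (q^-1 * (n.+1%:R^-1 - (n%:R^-1 - n%:R ^- 2)) +
    q ^- 2 * (n.+2%:R^-1 * n.+1%:R^-1 - n%:R ^- 2))))); last first.
  by field; rewrite !gt_eqF // nat1r ltr0n.
apply: le_trans (ler_normD _ _) (lerD h1 _).
apply: le_trans (ler_normD _ _) (lerD h2 _).
apply: le_trans (ler_normD _ _) (lerD h3 _).
exact: le_trans (ler_normD _ _) (lerD h4 h5).
Qed.

Lemma bexp_inv_sqr_expansion : exists C, forall n, (0 < n)%N ->
  `|bexp q n (fun N => (N%:R ^+ 2)^-1) - q ^- 2 / n%:R ^+ 2| <= C / n%:R ^+ 3.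
Proof.
exists (20 / q ^+ 3 + (6 / q ^+ 5 + 6 / q ^+ 4) + 3 / q ^+ 2) => n n0.
have n0R : 0 < n%:R :> R by rewrite ltr0n.
have h1 : `|bexp q n (fun N => (N%:R ^+ 2)^-1 - rising_inv2 N)|
    <= 20 / q ^+ 3 / n%:R ^+ 3.
  apply: (@le_trans _ _ (20 * bexp q n rising_inv3)); last first.
    by rewrite -mulrA; apply: ler_wpM2l => //; exact: bexp_rising_inv3_le.
  rewrite -bexpZ; apply: ler_norm_bexp => // -[|N] _.
    by rewrite /rising_inv2 /rising_inv3 expr0n /= invr0 ler_norml; lra.
  rewrite /rising_inv2 /rising_inv3.
  rewrite -(natr1 N.+3) -(natr1 N.+2) -(natr1 N.+1) -(natr1 N).
  have : 0 <= N%:R :> R by [].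
  set M : R := N%:R => M0.
  have M1 : 0 < M + 1 by lra.
  have M2 : 0 < M + 1 + 1 by lra.
  have M3 : 0 < M + 1 + 1 + 1 by lra.
  have M4 : 0 < M + 1 + 1 + 1 + 1 by lra.
  have D0 : 0 < (M + 1) ^+ 2 * (M + 1 + 1) * (M + 1 + 1 + 1).
    by rewrite !mulr_gt0.
  rewrite (_ : _ - _ = (3 * M + 5)
    / ((M + 1) ^+ 2 * (M + 1 + 1) * (M + 1 + 1 + 1)));
    last by field; rewrite !gt_eqF.
  rewrite ger0_norm; last by apply: divr_ge0; [lra | exact: ltW].
  rewrite ler_pdivrMr ?mulr_gt0 ?exprn_gt0 //.
  rewrite [leRHS](_ : _ = 20 * (M + 1) ^+ 2 / (M + 1 + 1 + 1 + 1)).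
    by rewrite ler_pdivlMr //; nra.
  by field; rewrite !gt_eqF.
have h3 := bexp_rising_inv2_approx n0.
have h5 := inv_shift2 n0.
rewrite bexpB in h1.
have q2i : 0 <= q ^- 2 by rewrite invr_ge0 exprn_ge0 // ltW.
have {}h5 := ler_wpM2l q2i h5; rewrite -[X in X * _ <= _](ger0_norm q2i) -normrM in h5.
rewrite [leRHS](_ : _ = 20 / q ^+ 3 / n%:R ^+ 3 + (
  (6 / q ^+ 5 + 6 / q ^+ 4) / n%:R ^+ 3 +
  q ^- 2 * (3 * n%:R ^- 3))); last by ring.
set X := bexp q n (fun N => _^-1); rewrite -/X in h1.
rewrite (_ : X - _ = (X - bexp q n rising_inv2) +
   ((bexp q n rising_inv2 - (n.+2%:R * q)^-1 * (n.+1%:R * q)^-1) +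
    q ^- 2 * (n.+2%:R^-1 * n.+1%:R^-1 - n%:R ^- 2))); last first.
  by field; rewrite !gt_eqF // nat1r ltr0n.
apply: le_trans (ler_normD _ _) (lerD h1 _).
exact: le_trans (ler_normD _ _) (lerD h3 h5).
Qed.

(** Small values of the binomial count do not matter: below the threshold from
    which r is under control, r is bounded by a multiple of rising_inv3, whose
    expectation is O(n^-3). *)
Lemma bexp_o2 (r : nat -> R) : r 0%N = 0 -> o2 r -> o2 (fun n => bexp q n r).
Proof.
move=> r0 ro e e0.
have q2 : 0 < q ^+ 2 by rewrite exprn_gt0.
have e'0 : 0 < e * q ^+ 2 / 12 by rewrite divr_gt0 // mulr_gt0.
have e2 : 0 <= e * q ^+ 2 / 2 by rewrite divr_ge0 // mulr_ge0 // ltW.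
have [N0 _ hN0] := ro _ e'0.
pose K := \sum_(M < N0) `|r M| / rising_inv3 M.
have K0 : 0 <= K.
  by apply: sumr_ge0 => M _; rewrite divr_ge0 // ltW // rising_inv3_gt0.
have bnd N : `|r N| <= e * q ^+ 2 / 2 * rising_inv2 N + K * rising_inv3 N.
  have i2 : 0 < rising_inv2 N by rewrite invr_gt0 mulr_gt0.
  have i3 := rising_inv3_gt0 N.
  have [NN0|NN0] := ltnP N N0.
    apply: ler_wpDl; first by rewrite mulr_ge0 // ltW.
    rewrite -ler_pdivrMr // /K (bigD1 (Ordinal NN0)) //= lerDl.
    by apply: sumr_ge0 => M _; rewrite divr_ge0 // ltW // rising_inv3_gt0.
  apply: ler_wpDr; first by rewrite mulr_ge0 // ltW.
  case: N {i3} NN0 i2 => [|N] NN0 i2.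
    by rewrite r0 normr0 mulr_ge0 // ltW.
  apply: le_trans (hN0 _ NN0) _.
  rewrite (_ : e * q ^+ 2 / 2 * _ = e * q ^+ 2 / 12 * (6 * rising_inv2 N.+1)).
    apply: ler_wpM2l; first exact: ltW.
    rewrite /rising_inv2 -(natr1 N.+2) -(natr1 N.+1) -(natr1 N).
    have : 0 <= N%:R :> R by [].
    set M : R := N%:R => M0.
    rewrite -[leLHS]mul1r ler_pdivrMr ?exprn_gt0 //; last by lra.
    rewrite mulrAC ler_pdivlMr; last by apply: mulr_gt0; lra.
    by nra.
  by field.
have := @o2_cubic R (fun n => K * bexp q n rising_inv3) (K * (q ^+ 3)^-1) _ (e / 2).
move=> H; apply: filterS2 near_n_gt0 (H _ _); last by rewrite divr_gt0.
  move=> n n0 hn; apply: (@le_trans _ _ (e * q ^+ 2 / 2 * bexp q n rising_inv2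
    + K * bexp q n rising_inv3)).
    rewrite -!bexpZ -bexpD; apply: ler_norm_bexp => // N _; exact: bnd.
  rewrite [leRHS](_ : _ = e * q ^+ 2 / 2 * (q ^- 2 / n%:R ^+ 2) + e / 2 / n%:R ^+ 2).
    apply: lerD; last by apply: le_trans hn; exact: ler_norm.
    apply: ler_wpM2l; last exact: bexp_rising_inv2_le_sqr.
    by rewrite divr_ge0 // mulr_ge0 // ltW.
  by field; rewrite !gt_eqF // ltr0n.
apply: filterS near_n_gt0 => n n0; rewrite ger0_norm; last first.
  apply: mulr_ge0 => //; rewrite -[X in X <= _](bexp_cst q n).
  by apply: ler_bexp => // N _; rewrite ltW // rising_inv3_gt0.
by rewrite -mulrA; apply: ler_wpM2l => //; exact: bexp_rising_inv3_le.
Qed.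

(** From a fixed to a binomial sample size. *)
Lemma bexp_expansion (g : nat -> R) (a b : R) :
  o2 (fun N => g N - (a / N%:R + b / N%:R ^+ 2)) ->
  o2 (fun n => bexp q n (fun N => if N is 0%N then 0 else g N)
     - (a / q / n%:R + (b + a * (1 - q)) / q ^+ 2 / n%:R ^+ 2)).
Proof.
move=> go.
pose r N := (if N is 0%N then 0 else g N) - (a / N%:R + b / N%:R ^+ 2).
have r0 : r 0%N = 0 by rewrite /r expr0n /= invr0 !mulr0; ring.
have ro : o2 r.
  by apply: o2_near go; apply: filterS near_n_gt0 => -[].
have [C1 h1] := bexp_inv_expansion; have [C2 h2] := bexp_inv_sqr_expansion.
have o1 : o2 (fun n => bexp q n (fun N => N%:R^-1) -
    (n%:R^-1 / q + (1 - q) / q ^+ 2 / n%:R ^+ 2)).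
  by apply: (o2_cubic (C := C1)); apply: filterS near_n_gt0.
have o2' : o2 (fun n => bexp q n (fun N => (N%:R ^+ 2)^-1) - q ^- 2 / n%:R ^+ 2).
  by apply: (o2_cubic (C := C2)); apply: filterS near_n_gt0.
apply: o2_near (o2D (bexp_o2 r0 ro) (o2D (o2Z a o1) (o2Z b o2'))).
apply: nearW => n; rewrite /r bexpB bexpD !bexpZ; ring.
Qed.

End InverseMoments.

(** * Expectations of functions of multinomial counts *)

Section DiscreteExpectation.
Context (R : realType) (d : measure_display) (T : measurableType d).
Variable P : probability T R.

Section OneVariable.
Variables (V : countType) (W : T -> V).
Hypothesis measW : forall v, measurable (W @^-1` [set v]).

Lemma measurable_preimage_count (A : set V) : measurable (W @^-1` A).
Proof.
rewrite (_ : W @^-1` A = \bigcup_v (if `[< A v >] then W @^-1` [set v] else set0)).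
  by apply: countable_bigcupT_measurable => // v; case: asboolP.
apply/seteqP; split => [t At|t [v _]].
  by exists (W t) => //; case: asboolP.
by case: asboolP => // Av /= ->.
Qed.

Variables (S : seq V) (w : V -> R).
Hypothesis uniqS : uniq S.
Hypothesis law : forall v, P (W @^-1` [set v]) = (w v)%:E.
Hypothesis mass : \sum_(v <- S) w v = 1.

Let simple (F : V -> R) (t : T) : R :=
  \sum_(v <- S) F v * \1_(W @^-1` [set v]) t.

Let simpleE F t : simple F t = if W t \in S then F (W t) else 0.
Proof.
rewrite /simple; case: ifPn => WS.
  rewrite (bigD1_seq (W t)) //= indicE mem_set // mulr1 big1 ?addr0 //.
  move=> v vW; rewrite indicE memNset ?mulr0 // => /= e.
  by rewrite e eqxx in vW.
rewrite big_seq big1 // => v vS; rewrite indicE memNset ?mulr0 // => /= e.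
by rewrite e vS in WS.
Qed.

Let integral_simple F :
  (\int[P]_t (simple F t)%:E = (\sum_(v <- S) w v * F v)%:E)%E.
Proof.
transitivity (\int[P]_t (\sum_(v <- S) (F v)%:E * (\1_(W @^-1` [set v]) t)%:E))%E.
  apply: eq_integral => t _; rewrite /simple -sumEFin.
  by apply: eq_bigr => v _; rewrite EFinM.
rewrite integral_sum //; last first.
  move=> v; apply: integrableZl => //.
  exact: integrable_indic.
rewrite -sumEFin; apply: eq_bigr => v _.
rewrite integralZl //; last first.
  exact: integrable_indic.
rewrite integral_indic // setIT mulrC EFinM; congr (_ * _)%E; exact: law.
Qed.

(** The values in S carry the whole mass, so F o W agrees almost surely with a
    simple function. *)
Lemma discrete_expectation (F : V -> R) :
  ('E_P[fun t => F (W t)] = (\sum_(v <- S) w v * F v)%:E)%E.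
Proof.
have PS : P [set t | W t \in S] = 1%E.
  have mS : measurable [set t | W t \in S].
    exact: (measurable_preimage_count [set v | v \in S]).
  rewrite -expectation_indic // unlock.
  transitivity (\int[P]_t (simple (fun=> 1) t)%:E)%E.
    apply: eq_integral => t _; rewrite simpleE indicE; congr (_%:E).
    case: ifPn => WS; first by rewrite mem_set.
    by rewrite memNset //=; exact/negP.
  rewrite integral_simple; congr (_%:E); rewrite -[RHS]mass.
  by apply: eq_bigr => v _; rewrite mulr1.
rewrite -integral_simple unlock; apply: ae_eq_integral => //.
- move=> _ B _; rewrite setTI.
  exact: (measurable_preimage_count ((fun v => (F v)%:E) @^-1` B)).
- rewrite (_ : (fun t => _) = fun t => if W t \in S then (F (W t))%:E else 0%E).
    move=> _ B _; rewrite setTI; exact: (measurable_preimage_count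
      ((fun v => if v \in S then (F v)%:E else 0%E) @^-1` B)).
  by apply/funext => t; rewrite simpleE; case: ifP.
exists [set t | W t \notin S]; split.
- exact: (measurable_preimage_count [set v | v \notin S]).
- rewrite (_ : [set t | W t \notin S] = ~` [set t | W t \in S]).
    have PN : P (~` [set t | W t \in S]) = 0%E.
      rewrite probability_setC ?PS ?subee //.
      exact: (measurable_preimage_count [set v | v \in S]).
    exact: PN.
  by apply/seteqP; split => t /= /negP.
- move=> t /= H; apply/negP => WS; apply: H => _; by rewrite simpleE WS.
Qed.

End OneVariable.

(** No count of a sample of size n exceeds n, so the expectation is a finite
    sum. *)
Lemma mexp_sum_pmf (K : finType) (q : K -> R) n F :
  mexp q n F = \sum_(x : {ffun K -> 'I_n.+1})
    multinomial_pmf n q (fun a => x a : nat) * F (fun a => x a : nat).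
Proof.
rewrite (@eq_mexp _ _ _ _ _ (fun y => \sum_(x : {ffun K -> 'I_n.+1})
    F (fun a => x a : nat) * (`[< y = (fun a => x a : nat) >])%:R)); last first.
  move=> y yn.
  have yle a : (y a < n.+1)%N by rewrite ltnS -yn (bigD1 a) //= leq_addr.
  have yE : y = fun a => [ffun a => Ordinal (yle a)] a.
    by apply/funext => a; rewrite ffunE.
  rewrite (bigD1 [ffun a => Ordinal (yle a)]) //= -yE asboolT // mulr1.
  rewrite big1 ?addr0 // => x xy; rewrite asboolF ?mulr0 // => e.
  move/eqP: xy; apply; apply/ffunP => a; apply/val_inj.
  by rewrite ffunE /= e.
rewrite mexp_sum; apply: eq_bigr => x _.
by rewrite mexpZ mexp_indicator mulrC.
Qed.

Lemma measurable_counts (K : finType) (Y : K -> {RV P >-> nat}) (x : K -> nat) :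
  measurable [set t | forall a, Y a t = x a].
Proof.
rewrite (_ : mkset _ = ~` \bigcup_a ~` (Y a @^-1` [set x a])); last first.
  apply/seteqP; split => t /=; first by move=> h [a _]; apply; exact: h.
  by move=> h a; apply: contrapT => ha; apply: h; exists a.
apply: measurableC; apply: countable_bigcupT_measurable => // a.
by apply: measurableC; rewrite -[X in measurable X]setTI; exact: measurable_funPT.
Qed.

Lemma measurable_count_event (K : finType) (Y : K -> {RV P >-> nat})
  (A : set (K -> nat)) : measurable [set t | A (fun a => Y a t)].
Proof.
pose W t := [ffun a => Y a t].
rewrite (_ : mkset _ = W @^-1` [set v | A v]); last first.
  apply/seteqP; split => t /=; rewrite (_ : (fun a => Y a t) = W t) //;
  by apply/funext => a; rewrite ffunE.
apply: measurable_preimage_count => v.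
rewrite (_ : _ @^-1` _ = [set t | forall a, Y a t = v a]).
  exact: measurable_counts.
apply/seteqP; split => t /=; first by move=> <- a; rewrite ffunE.
by move=> h; apply/ffunP => a; rewrite ffunE.
Qed.

Let to_nat (K : finType) n (x : {ffun K -> 'I_n.+1}) : {ffun K -> nat} :=
  [ffun a => x a : nat].

Let to_nat_inj (K : finType) n : injective (@to_nat K n).
Proof.
move=> x y /ffunP xy; apply/ffunP => a; apply/val_inj.
by have := xy a; rewrite !ffunE.
Qed.

Let to_natE (K : finType) n (x : {ffun K -> 'I_n.+1}) :
  to_nat x = (fun a => x a : nat) :> (K -> nat).
Proof. by apply/funext => a; rewrite ffunE. Qed.

Lemma multinomial_expectation (K : finType) (Y : K -> {RV P >-> nat}) n
    (q : K -> R) (F : (K -> nat) -> R) :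
  \sum_a q a = 1 -> multinomial_law Y n q ->
  ('E_P[fun t => F (fun a => Y a t)] = (mexp q n F)%:E)%E.
Proof.
move=> q1 lawY; pose W t := [ffun a => Y a t].
have WE (v : {ffun K -> nat}) : W @^-1` [set v] = [set t | forall a, Y a t = v a].
  apply/seteqP; split => t /=; first by move=> <- a; rewrite ffunE.
  by move=> h; apply/ffunP => a; rewrite ffunE.
have -> : (fun t => F (fun a => Y a t)) = fun t => (fun v : {ffun K -> nat} => F v) (W t).
  by apply/funext => t; congr F; apply/funext => a; rewrite ffunE.
apply: (etrans (@discrete_expectation _ W _ [seq to_nat x | x : {ffun K -> 'I_n.+1}]
  (fun v => multinomial_pmf n q v) _ _ _ (fun v => F v))).
- by move=> v; rewrite WE; exact: measurable_counts.
- by rewrite map_inj_uniq ?enum_uniq //; exact: to_nat_inj.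
- by move=> v; rewrite WE; exact: lawY.
- rewrite big_map big_enum /= -[RHS](mexp_cst n 1 q1) mexp_sum_pmf.
  by apply: eq_bigr => x _; rewrite to_natE mulr1.
- rewrite mexp_sum_pmf big_map big_enum /=; congr (_%:E).
  by apply: eq_bigr => x _; rewrite to_natE.
Qed.

Lemma independent_multinomial_expectation (K L : finType)
    (Y : K -> {RV P >-> nat}) (Z : L -> {RV P >-> nat}) n k
    (p : K -> R) (q : L -> R) (F : (K -> nat) -> (L -> nat) -> R) :
  \sum_a p a = 1 -> \sum_b q b = 1 ->
  multinomial_law Y n p -> multinomial_law Z k q -> independent_counts Y Z ->
  ('E_P[fun t => F (fun a => Y a t) (fun b => Z b t)] =
    (mexp p n (fun x => mexp q k (F x)))%:E)%E.
Proof.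
move=> p1 q1 lawY lawZ indep.
pose W t := ([ffun a => Y a t], [ffun b => Z b t]).
have WE v : W @^-1` [set v] =
    [set t | forall a, Y a t = v.1 a] `&` [set t | forall b, Z b t = v.2 b].
  case: v => v1 v2; apply/seteqP; split => t /=.
    by move=> [<- <-]; split=> a; rewrite ffunE.
  by move=> [h1 h2]; congr pair; apply/ffunP => a; rewrite ffunE.
have -> : (fun t => F (fun a => Y a t) (fun b => Z b t)) =
    fun t => (fun v : {ffun K -> nat} * {ffun L -> nat} => F v.1 v.2) (W t).
  by apply/funext => t; congr F; apply/funext => a; rewrite ffunE.
pose S := [seq (to_nat x.1, to_nat x.2) | x : {ffun K -> 'I_n.+1} * {ffun L -> 'I_k.+1}].
have sumS (G : (K -> nat) -> (L -> nat) -> R) :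
    \sum_(v <- S) multinomial_pmf n p v.1 * multinomial_pmf k q v.2 * G v.1 v.2
    = mexp p n (fun x => mexp q k (G x)).
  rewrite mexp_sum_pmf; under [RHS]eq_bigr => x _ do rewrite mexp_sum_pmf mulr_sumr.
  rewrite pair_big /= big_map big_enum /=.
  by apply: eq_bigr => x _; rewrite !to_natE mulrA.
apply: (etrans (@discrete_expectation _ W _ S
  (fun v => multinomial_pmf n p v.1 * multinomial_pmf k q v.2) _ _ _
  (fun v => F v.1 v.2))).
- by move=> v; rewrite WE; apply: measurableI; exact: measurable_counts.
- rewrite map_inj_uniq ?enum_uniq // => -[x1 x2] [y1 y2] /= [].
  by move=> /to_nat_inj -> /to_nat_inj ->.
- move=> v; rewrite WE EFinM -lawY -lawZ.
  rewrite -(indep [set x | forall a, x a = v.1 a] [set y | forall b, y b = v.2 b]).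
  by [].
- rewrite -[RHS](mexp_cst n 1 p1).
  rewrite -(@eq_mexp _ _ p n (fun=> mexp q k (fun=> 1))); last first.
    by move=> x _; rewrite mexp_cst.
  by rewrite -(sumS (fun _ _ => 1)); apply: eq_bigr => v _; rewrite mulr1.
- by rewrite sumS.
Qed.

End DiscreteExpectation.

(** * Probability simplices and the Kullback-Leibler divergence *)

Section ClosedSimplex.
Variable R : realType.

Lemma closure_rowP (J : nat) (M : set 'rV[R]_J) (q : 'rV[R]_J) :
  closure M q <-> forall e, 0 < e ->
    exists2 r, M r & forall j, `|q ord0 j - r ord0 j| < e.
Proof.
split=> [Mq e e0|Mq B /nbhs_ballP[e e0 eB]].
  have [r [Mr [_ qr]]] := Mq _ (nbhsx_ballx q e e0).
  by exists r => // j; exact: qr.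
have [r Mr qr] := Mq e e0; exists r; split => //; apply: eB.
by split => // i j; rewrite !ord1; exact: qr.
Qed.

Definition closed_simplex (J : nat) : set 'rV[R]_J :=
  [set q | (forall j, 0 <= q ord0 j) /\ \sum_j q ord0 j = 1].

Lemma closure_sub_simplex (J : nat) (M : set 'rV[R]_J) :
  M `<=` @open_simplex R J -> closure M `<=` @closed_simplex J.
Proof.
move=> MS q /closure_rowP Mq; split=> [j|].
  rewrite leNgt; apply/negP => qj.
  have [|r /MS[r0 _] /(_ j)] := Mq (- q ord0 j); first by rewrite oppr_gt0.
  by have := r0 j; rewrite ltr_norml; lra.
apply/eqP; rewrite -subr_eq0 -normr_le0; apply/ler_addgt0Pr => e e0.
rewrite add0r; have J0 : 0 < J%:R + 1 :> R by rewrite ltr_wpDl.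
have [r /MS[_ r1] qr] := Mq _ (divr_gt0 e0 J0).
rewrite -r1 -sumrB; apply: le_trans (ler_norm_sum _ _ _) _.
apply: (@le_trans _ _ (\sum_(j < J) e / (J%:R + 1))).
  by apply: ler_sum => j _; exact: ltW.
rewrite sumr_const card_ord -[leLHS]mulr_natl mulrA ler_pdivrMr // mulrC.
by rewrite ler_wpM2l ?lerDl // ltW.
Qed.

(** Mixing q with the uniform distribution makes it positive. *)
Lemma closure_open_simplex (J : nat) : (0 < J)%N ->
  @closed_simplex J `<=` closure (@open_simplex R J).
Proof.
move=> J0 q [q0 q1]; apply/closure_rowP => e e0.
have J0R : 0 < J%:R :> R by rewrite ltr0n.
pose t := Num.min (e / 2) (2^-1 : R).
have t0 : 0 < t by rewrite lt_min divr_gt0 //= invr_gt0.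
have te : t < e by rewrite gt_min; apply/orP; left; lra.
have t1 : t < 1 by rewrite gt_min; apply/orP; right; lra.
have qle j : q ord0 j <= 1.
  by rewrite -q1 (bigD1 j) //= lerDl sumr_ge0.
have J1 : J%:R^-1 <= 1 :> R by rewrite invf_le1 // ler1n.
have J2 : 0 < J%:R^-1 :> R by rewrite invr_gt0.
exists (\row_j ((1 - t) * q ord0 j + t / J%:R)); last first.
  move=> j; rewrite mxE.
  have := q0 j; have := qle j; rewrite ltr_norml => qj1 qj0; apply/andP; split; nra.
split=> [j|].
  rewrite mxE ltr_wpDl //; first by rewrite mulr_ge0 // subr_ge0 ltW.
  by rewrite mulr_gt0.
under eq_bigr do rewrite mxE.
rewrite big_split /= -mulr_sumr q1 sumr_const card_ord -mulr_natr.
by field; rewrite gt_eqF.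
Qed.

(** With x = q_j / p_j, the term is p_j x ln x, and
    x - 1 <= x ln x <= x (x - 1). *)
Lemma KL_bounded (J : nat) (p : 'I_J -> R) : (forall j, 0 < p j) ->
  exists2 C, 0 <= C & forall q, @closed_simplex J q -> `|KL (q ord0) p| <= C.
Proof.
move=> p0; exists (\sum_j p j * (1 + (p j)^-1) ^+ 2).
  by apply: sumr_ge0 => j _; rewrite mulr_ge0 ?exprn_even_ge0 // ltW.
move=> q [q0 q1]; rewrite /KL; apply: le_trans (ler_norm_sum _ _ _) _.
apply: ler_sum => j _.
have qj : q ord0 j <= 1 by rewrite -q1 (bigD1 j) //= lerDl sumr_ge0.
set x := q ord0 j / p j.
have xle : 0 <= x <= (p j)^-1.
  rewrite divr_ge0 ?(ltW (p0 j)) //= -[leRHS]mul1r ler_wpM2r //.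
  by rewrite invr_ge0 ltW.
rewrite (_ : q ord0 j * ln x = p j * (x * ln x)); last first.
  by rewrite /x; field; rewrite gt_eqF.
rewrite normrM gtr0_norm //; apply: ler_wpM2l; first exact: ltW.
set y := (p j)^-1 in xle *; case/andP: xle => x0 xy.
have [->|xN0] := eqVneq x 0; first by rewrite mul0r normr0 exprn_even_ge0.
have xp : 0 < x by rewrite lt_def xN0.
have up := ler_wpM2l x0 (ln_le_subr1 xp).
have := @ln_le_subr1 R x^-1; rewrite invr_gt0 lnV ?posrE // => /(_ xp).
move=> /(ler_wpM2l x0); rewrite mulrBr mulfV // => lo.
rewrite ler_norml; apply/andP; split; nra.
Qed.

Lemma ln_prod (K : finType) (F : K -> R) :
  (forall a, 0 < F a) -> ln (\prod_a F a) = \sum_a ln (F a).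
Proof.
move=> F0; suff [] : 0 < \prod_a F a /\ ln (\prod_a F a) = \sum_a ln (F a) by [].
apply: (big_ind2 (fun x y => 0 < x /\ ln x = y)) => //; first by rewrite ln1.
by move=> x1 y1 x2 y2 [x1p <-] [x2p <-]; rewrite mulr_gt0 // lnM ?posrE.
Qed.

(** Applying ln y <= y - 1 to the square root s of x gives
    s^2 - 1 <= 2 (s - 1), that is (s - 1)^2 <= 0. *)
Lemma ln_eq_subr1 (x : R) : 0 < x -> ln x = x - 1 -> x = 1.
Proof.
move=> x0 lnx; set s := Num.sqrt x.
have s0 : 0 < s by rewrite sqrtr_gt0.
have xE : x = s ^+ 2 by rewrite sqr_sqrtr // ltW.
move: lnx; rewrite xE lnXn // -mulr_natl => lnx.
have lns := ln_le_subr1 s0.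
have s1 : (s - 1) ^+ 2 <= 0 by nra.
have : s - 1 = 0 by apply/eqP; rewrite -sqrf_eq0 eq_le s1 sqr_ge0.
by move/eqP; rewrite subr_eq0 => /eqP ->; rewrite expr1n.
Qed.

(** Equality case of Gibbs' inequality. Let u_j be the ratio of q_j to the
    relative frequency. The likelihood of q being maximal, the sum of the
    x_j ln u_j is nonnegative, while ln u <= u - 1 bounds it above by 0; hence
    ln u_j = u_j - 1, so u_j = 1, whenever x_j > 0. *)
Lemma full_MLE (J : nat) (x : 'I_J -> nat) (q : 'rV[R]_J) : (0 < J)%N ->
  (\sum_j x j)%N <> 0%N -> is_MLE (@open_simplex R J) x q ->
  forall j, q ord0 j = (x j)%:R / (\sum_j x j)%:R.
Proof.
move=> J0; set N := (\sum_j x j)%N => /eqP N0 [qM qmax].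
have [q0 q1] := closure_sub_simplex (@subset_refl _ _) qM.
have NR : 0 < N%:R :> R by rewrite ltr0n lt0n.
pose r : 'rV[R]_J := \row_j ((x j)%:R / N%:R).
have rM : closure (@open_simplex R J) r.
  apply: closure_open_simplex => //; split=> [j|]; first by rewrite mxE divr_ge0.
  under eq_bigr do rewrite mxE.
  by rewrite -mulr_suml -natr_sum mulfV ?gt_eqF.
have := qmax _ rM; rewrite /multinomial_pmf eqxx ler_pM2l; last first.
  rewrite divr_gt0 ?ltr0n ?fact_gt0 // prodn_gt0 // => j.
  by rewrite fact_gt0.
move=> prodle.
have prod_r : 0 < \prod_j r ord0 j ^+ x j.
  apply: prodr_gt0 => j _; rewrite mxE.
  by case: (x j) => [|k]; rewrite ?expr0 // exprn_gt0 // divr_gt0.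
have prod_q := lt_le_trans prod_r prodle.
have qpos j : (0 < x j)%N -> 0 < q ord0 j.
  move=> xj; rewrite lt_def q0 andbT; apply/eqP => qj.
  by move: prod_q; rewrite (bigD1 j) //= qj expr0n gtn_eqF // mul0r ltxx.
pose u j := q ord0 j / r ord0 j.
have rpos j : (0 < x j)%N -> 0 < r ord0 j.
  by move=> xj; rewrite mxE divr_gt0 // ltr0n.
have u_gt0 j : (0 < x j)%N -> 0 < u j.
  by move=> xj; rewrite divr_gt0 ?rpos ?qpos.
have lnu : 0 <= \sum_j (x j)%:R * ln (u j).
  have F0 j : 0 < u j ^+ x j.
    have [->|xj] := posnP (x j); first by rewrite expr0.
    by rewrite exprn_gt0 // u_gt0.
  have -> : \sum_j (x j)%:R * ln (u j) = ln (\prod_j u j ^+ x j).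
    rewrite ln_prod //; apply: eq_bigr => j _.
    have [->|xj] := posnP (x j); first by rewrite mul0r expr0 ln1.
    by rewrite lnXn ?u_gt0 // mulr_natl.
  apply: ln_ge0; rewrite (_ : \prod_j _ = \prod_j q ord0 j ^+ x j / \prod_j r ord0 j ^+ x j).
    by rewrite ler_pdivlMr // mul1r.
  by rewrite -prodf_div; apply: eq_bigr => j _; rewrite expr_div_n.
(* The slack in x_j ln u_j <= x_j (u_j - 1), completed by N q_j when
   x_j = 0. *)
pose gap j := N%:R * q ord0 j - (x j)%:R - (x j)%:R * ln (u j).
have uE j : (0 < x j)%N -> (x j)%:R * u j = N%:R * q ord0 j.
  move=> xj; rewrite /u mxE; field.
  by rewrite gt_eqF // pnatr_eq0 -lt0n.
have gap0 j : 0 <= gap j.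
  rewrite /gap; have [->|xj] := posnP (x j).
    by rewrite mul0r !subr0 mulr_ge0.
  have xj0 : 0 <= (x j)%:R :> R by [].
  have := ler_wpM2l xj0 (ln_le_subr1 (u_gt0 _ xj)).
  by rewrite mulrBr uE // mulr1 -subr_ge0.
have sgap : \sum_j gap j = 0.
  apply/eqP; rewrite eq_le sumr_ge0 // andbT.
  rewrite /gap !sumrB -mulr_sumr q1 mulr1 -natr_sum subrr sub0r.
  by rewrite oppr_le0.
have gapE j : gap j = 0.
  by move/eqP: sgap; rewrite psumr_eq0 // => /allP/(_ j); rewrite mem_index_enum => /(_ isT)/eqP.
move=> j; have := gapE j; rewrite /gap; have [->|xj] := posnP (x j).
  rewrite mul0r !subr0 mul0r => /eqP; rewrite mulf_eq0 gt_eqF //= => /eqP -> //.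
rewrite -uE // => gj.
have xj0 : (x j)%:R != 0 :> R by rewrite pnatr_eq0 -lt0n.
have lnuE : ln (u j) = u j - 1.
  apply: (mulfI xj0); rewrite mulrBr mulr1; apply/esym/eqP.
  by rewrite -subr_eq0 gj.
have := uE j xj; rewrite (ln_eq_subr1 (u_gt0 _ xj) lnuE) mulr1 => ->.
by rewrite mulrC mulKf // gt_eqF.
Qed.

(** The chain rule for the divergence; y need not sum to 1. *)
Lemma KL_two_stage (I : nat) (J : 'I_I -> nat) (m : category J -> R)
    (y : 'I_I -> R) (r : forall i, 'I_(J i) -> R) :
  (forall c, 0 < m c) -> (forall i, 0 < first_stage m i) ->
  (forall i, 0 <= y i) ->
  (forall i j, 0 <= r i j) -> (forall i, \sum_j r i j = 1) ->
  KL (fun c : category J => y (tag c) * r (tag c) (tagged c)) m =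
  KL y (first_stage m) + \sum_i y i * KL (r i) (second_stage m i ord0).
Proof.
move=> m0 m10 y0 r0 r1; rewrite /KL.
pose f i (j : 'I_(J i)) := y i * r i j * ln (y i * r i j / m (Cat j)).
transitivity (\sum_i \sum_(j < J i) f i j).
  rewrite (sig_big_dep (fun _ => true) (fun _ _ => true) f) /=.
  by apply: eq_bigr => -[i j] _.
rewrite -big_split /=; apply: eq_bigr => i _.
transitivity (\sum_(j < J i) (r i j * (y i * ln (y i / first_stage m i))
   + y i * (r i j * ln (r i j / second_stage m i ord0 j)))); last first.
  by rewrite big_split /= -mulr_suml r1 mul1r -mulr_sumr.
apply: eq_bigr => j _; rewrite /f mxE.
have [->|yN0] := eqVneq (y i) 0; first by rewrite !mul0r !mulr0 addr0.
have [->|rN0] := eqVneq (r i j) 0; first by rewrite !mulr0 !mul0r mulr0 addr0.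
have yp : 0 < y i by rewrite lt_def yN0 y0.
have rp : 0 < r i j by rewrite lt_def rN0 r0.
rewrite (_ : y i * r i j / m (Cat j) = (y i / first_stage m i) *
   (r i j / (m (Cat j) / first_stage m i))); last first.
  by field; rewrite !gt_eqF.
by rewrite lnM ?posrE ?divr_gt0 //; ring.
Qed.
End ClosedSimplex.

(** * The two-stage estimator *)

Section TwoStage.
Variables (R : realType) (I : nat) (J : 'I_I -> nat) (m : category J -> R).
Variable phat : forall i, ('I_(J i) -> nat) -> 'rV[R]_(J i).
Arguments phat : clear implicits.
Hypothesis J_gt0 : forall i, (0 < J i)%N.
Hypothesis m_gt0 : forall c, 0 < m c.
Hypothesis m_sum1 : \sum_c m c = 1.
Hypothesis phat_simplex : forall i x, (\sum_j x j)%N <> 0%N ->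
  closed_simplex (phat i x).

Let m1 := first_stage m.
Let p i : 'I_(J i) -> R := second_stage m i ord0.
Arguments p : clear implicits.

Lemma first_stage_gt0 i : 0 < m1 i.
Proof.
rewrite /m1 /first_stage (bigD1 (Ordinal (J_gt0 i))) //=.
by rewrite ltr_wpDr // sumr_ge0 // => j _; exact: ltW.
Qed.

Lemma first_stage_sum1 : \sum_i m1 i = 1.
Proof.
rewrite -m_sum1 /m1 /first_stage.
rewrite (sig_big_dep (fun _ => true) (fun _ _ => true)
  (fun i (j : 'I_(J i)) => m (Cat j))) /=.
by apply: eq_bigr => -[i j] _.
Qed.

Lemma first_stage_gt0_le1 i : 0 < m1 i <= 1.
Proof.
rewrite first_stage_gt0 /= -first_stage_sum1 (bigD1 i) //= lerDl.
by apply: sumr_ge0 => j _; exact/ltW/first_stage_gt0.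
Qed.

Lemma second_stage_gt0 i j : 0 < p i j.
Proof. by rewrite /p mxE divr_gt0 // first_stage_gt0. Qed.

Lemma second_stage_sum1 i : \sum_j p i j = 1.
Proof.
rewrite /p; under eq_bigr do rewrite mxE.
by rewrite -mulr_suml mulfV // gt_eqF // first_stage_gt0.
Qed.

Lemma mexp_cell n i (F : ('I_(J i) -> nat) -> R) :
  mexp m n (fun x => F (fun j => x (Cat j))) =
  bexp (m1 i) n (fun N => mexp (p i) N F).
Proof.
have injC : injective (@Cat I J i).
  by move=> j k /eqP; rewrite /Cat eq_Tagged => /eqP.
rewrite (@mexp_lump _ _ _ (@Cat I J i) m n F injC m_sum1) //; last first.
  by rewrite gt_eqF // first_stage_gt0.
congr bexp; apply/funext => N; congr mexp; apply/funext => j.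
by rewrite /p mxE.
Qed.

Definition empty_cell i (x : category J -> nat) : bool :=
  (\sum_(j < J i) x (Cat j) == 0)%N.
Definition nonempty_cells (x : category J -> nat) : bool :=
  [forall i, ~~ empty_cell i x].

Definition nonempty_prob n := mexp m n (fun x => (nonempty_cells x)%:R).

Lemma empty_cell_prob n i :
  mexp m n (fun x => (empty_cell i x)%:R) = bexp (m1 i) n (@zero_indicator R).
Proof.
rewrite (mexp_cell n (fun z => (\sum_j z j == 0)%N%:R)).
apply: eq_bexp => N _; rewrite -[RHS](mexp_cst N (zero_indicator R N) (second_stage_sum1 i)).
by apply: eq_mexp => z ->; rewrite /zero_indicator; case: N.
Qed.

Let m_ge0 c : 0 <= m c. Proof. exact: ltW. Qed.

Lemma nonempty_prob_le1 n : nonempty_prob n <= 1.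
Proof.
rewrite -[leRHS](mexp_cst n 1 m_sum1); apply: ler_mexp => // x _.
by rewrite lern1 leq_b1.
Qed.

(** Union bound over the empty cells. *)
Lemma nonempty_prob_compl_le : exists2 C, 0 <= C & forall n, (0 < n)%N ->
  1 - nonempty_prob n <= C / n%:R ^+ 3.
Proof.
exists (\sum_i 6 / m1 i ^+ 3).
  apply: sumr_ge0 => i _; rewrite divr_ge0 // exprn_ge0 // ltW //.
  exact: first_stage_gt0.
move=> n n0; rewrite mulr_suml.
apply: (@le_trans _ _ (\sum_i bexp (m1 i) n (@zero_indicator R))); last first.
  by apply: ler_sum => i _; apply: bexp_zero_le => //; exact: first_stage_gt0_le1.
rewrite -(eq_bigr _ (fun i _ => empty_cell_prob n i)) -mexp_sum.
rewrite -[X in X - _](mexp_cst n 1 m_sum1) -mexpB; apply: ler_mexp => // x _.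
rewrite /nonempty_cells; case: (boolP [forall i, _]) => [_|].
  by rewrite subrr sumr_ge0.
rewrite negb_forall => /existsP[i]; rewrite negbK => ei.
by rewrite subr0 (bigD1 i) //= ei lerDl sumr_ge0.
Qed.

Definition second_stage_risk i N : R :=
  mexp (p i) N (fun z => KL (phat i z ord0) (p i)).

Definition cell_loss i n : R := mexp m n (fun x =>
  (nonempty_cells x)%:R * KL (phat i (fun j => x (Cat j)) ord0) (p i)).

(** Replacing the event that no cell is empty by the event that the cell i is
    not empty changes a bounded integrand on an event of probability
    O(n^-3). *)
Lemma cell_loss_approx i :
  o2 (fun n => cell_loss i n -
    bexp (m1 i) n (fun N => if N is 0%N then 0 else second_stage_risk i N)).
Proof.
have [C C0 hC] := KL_bounded (@second_stage_gt0 i).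
have [E E0 hE] := nonempty_prob_compl_le.
apply: (o2_cubic (C := C * E)); apply: filterS near_n_gt0 => n n0.
have -> : bexp (m1 i) n (fun N => if N is 0%N then 0 else second_stage_risk i N) =
    mexp m n (fun x => (~~ empty_cell i x)%:R *
      KL (phat i (fun j => x (Cat j)) ord0) (p i)).
  rewrite (mexp_cell n (fun z => (~~ (\sum_j z j == 0)%N)%:R * KL (phat i z ord0) (p i))).
  apply: eq_bexp => N _; case: N => [|N].
    by rewrite -[LHS](mexp0 (p i) 0); apply: eq_mexp => z ->; rewrite mul0r.
  by apply: eq_mexp => z ->; rewrite mul1r.
rewrite /cell_loss -mexpB -mulrA.
apply: (@le_trans _ _ (C * (1 - nonempty_prob n))); last first.
  by apply: ler_wpM2l => //; exact: hE.
rewrite -[X in X - _](mexp_cst n 1 m_sum1) -mexpB -mexpZ.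
apply: ler_norm_mexp => // x _; rewrite -mulrBl normrM.
rewrite /nonempty_cells; case: (boolP [forall i, _]) => [/forallP/(_ i) ->|_].
  by rewrite !subrr normr0 mul0r mulr0.
rewrite subr0 mulr1; case: (boolP (empty_cell i x)) => [_|ei].
  by rewrite subrr normr0 mul0r.
rewrite sub0r normrN normr1 mul1r; apply: hC; apply: phat_simplex.
exact/eqP.
Qed.

Lemma cell_loss_bounded i : exists2 C, 0 <= C & forall n, `|cell_loss i n| <= C.
Proof.
have [C C0 hC] := KL_bounded (@second_stage_gt0 i).
exists C => // n; rewrite -[leRHS](mexp_cst n C m_sum1).
apply: ler_norm_mexp => // x _; rewrite normrM.
rewrite /nonempty_cells; case: (boolP [forall i, _]) => [/forallP/(_ i) ei|_].
  rewrite normr1 mul1r; apply: hC; apply: phat_simplex; exact/eqP.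
by rewrite normr0 mul0r.
Qed.

Lemma nonempty_prob_half : \forall n \near \oo, 2^-1 <= nonempty_prob n.
Proof.
have [E E0 hE] := nonempty_prob_compl_le.
have : o2 (fun n => 1 - nonempty_prob n).
  apply: (o2_cubic (C := E)); apply: filterS near_n_gt0 => n n0.
  by rewrite ger0_norm ?hE // subr_ge0 nonempty_prob_le1.
have h2 : 0 < 2^-1 :> R by rewrite invr_gt0.
move=> /(_ _ h2); apply: filterS2 near_n_gt0 => n n0 h.
have : 2^-1 / n%:R ^+ 2 <= 2^-1 :> R.
  by rewrite ler_piMr // invf_le1 ?exprn_gt0 ?ltr0n // exprn_ege1 // ler1n.
have := le_trans (ler_norm _) h; lra.
Qed.

(** The conditioning probability is 1 + O(n^-3), and the loss is bounded. *)
Lemma conditional_cell_loss_approx i :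
  o2 (fun n => cell_loss i n / nonempty_prob n - cell_loss i n).
Proof.
have [C C0 hC] := cell_loss_bounded i.
have [E E0 hE] := nonempty_prob_compl_le.
apply: (o2_cubic (C := 2 * C * E)).
apply: filterS2 near_n_gt0 nonempty_prob_half => n n0 half.
set P := nonempty_prob n in half *; have P0 : 0 < P by lra.
rewrite (_ : _ - _ = cell_loss i n * (1 - P) / P); last by field; rewrite gt_eqF.
have P1 : 0 <= 1 - P by rewrite subr_ge0 nonempty_prob_le1.
rewrite !normrM (ger0_norm P1) [X in _ * X](gtr0_norm (x := P^-1)) ?invr_gt0 //.
rewrite (_ : _ / n%:R ^+ 3 = C * (E / n%:R ^+ 3) * 2); last by ring.
apply: ler_pM => //; first by rewrite mulr_ge0.
- by rewrite invr_ge0 ltW.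
- by apply: ler_pM => //; exact: hE.
- by rewrite -[leRHS]invrK lef_pV2 ?posrE ?invr_gt0.
Qed.

Definition first_stage_risk k : R :=
  mexp m1 k (fun y => KL (fun i => (y i)%:R / k%:R) m1).

Section Risk.
Context (d : measure_display) (T : measurableType d) (P : probability T R).
Variables (X : category J -> {RV P >-> nat}) (Xs : 'I_I -> {RV P >-> nat}).
Variables (n k : nat).
Hypothesis lawX : multinomial_law X n m.
Hypothesis lawXs : multinomial_law Xs k m1.
Hypothesis indep : independent_counts X Xs.

Let indicatorE t : \1_(no_empty_cell X) t = (nonempty_cells (X^~ t))%:R :> R.
Proof.
rewrite indicE; congr (_%:R); congr nat_of_bool.
apply/idP/idP => [/set_mem h|/forallP h].
  by apply/forallP => i; apply/eqP/h.
by rewrite inE => i; apply/eqP/h.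
Qed.

Lemma no_empty_cell_prob : P (no_empty_cell X) = (nonempty_prob n)%:E.
Proof.
rewrite -expectation_indic; last first.
  exact: (measurable_count_event X
    [set x | forall i, (\sum_(j < J i) x (Cat j))%N <> 0%N]).
rewrite -(multinomial_expectation (fun x => (nonempty_cells x)%:R) m_sum1 lawX).
by congr expectation; apply/funext => t; rewrite indicatorE.
Qed.

(** The chain rule is applied for a fixed present survey; averaging over the
    independent prior survey then replaces the first-stage frequencies by m1. *)
Lemma risk_formula : (0 < k)%N -> nonempty_prob n != 0 ->
  risk m phat X k Xs = first_stage_risk k +
    \sum_i m1 i * (cell_loss i n / nonempty_prob n).
Proof.
move=> k0 Pn0.
have kR : k%:R != 0 :> R by rewrite pnatr_eq0 -lt0n.
pose F (x : category J -> nat) (y : 'I_I -> nat) : R :=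
  KL (fun c => (y (tag c))%:R / k%:R *
    phat (tag c) (fun j => x (Cat j)) ord0 (tagged c)) m * (nonempty_cells x)%:R.
rewrite /risk /cond_expectation no_empty_cell_prob.
rewrite (_ : _ \* _ = fun t => F (fun c => X c t) (fun i => Xs i t)); last first.
  by apply/funext => t; rewrite /= indicatorE.
rewrite (independent_multinomial_expectation F m_sum1 first_stage_sum1 lawX lawXs indep) /=.
have mean_m1 i : mexp m1 k (fun y => (y i)%:R / k%:R) = m1 i.
  rewrite (mexp_coord k i (fun N => N%:R / k%:R) first_stage_sum1).
  by rewrite bexp_size_bias bexp_cst; field.
have inner x : mexp m1 k (F x) = (nonempty_cells x)%:R * (first_stage_risk k)
   + \sum_i m1 i * ((nonempty_cells x)%:R * KL (phat i (fun j => x (Cat j)) ord0) (p i)).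
  rewrite /F; case: (boolP (nonempty_cells x)) => [/forallP ne|_]; last first.
    rewrite mul0r add0r big1; last by move=> i _; rewrite mul0r mulr0.
    by rewrite -[RHS](mexp0 m1 k); apply: eq_mexp => y _; rewrite mulr0.
  have simplex i : closed_simplex (phat i (fun j => x (Cat j))).
    by apply: phat_simplex; apply/eqP/ne.
  rewrite (@eq_mexp _ _ _ _ _ (fun y => KL (fun i => (y i)%:R / k%:R) m1 +
     \sum_i KL (phat i (fun j => x (Cat j)) ord0) (p i) * ((y i)%:R / k%:R))).
    rewrite mexpD -/(first_stage_risk k) mul1r; congr (_ + _).
    rewrite mexp_sum; apply: eq_bigr => i _.
    by rewrite mexpZ mean_m1 mul1r mulrC.
  move=> y _; rewrite mulr1.
  rewrite (@KL_two_stage _ _ _ m (fun i => (y i)%:R / k%:R)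
    (fun i => phat i (fun j => x (Cat j)) ord0)) //.
  - by congr (_ + _); apply: eq_bigr => i _; rewrite mulrC.
  - exact: first_stage_gt0.
  - by move=> i j; have [] := simplex i.
  - by move=> i; have [] := simplex i.
rewrite (_ : mexp m n _ = nonempty_prob n * first_stage_risk k +
    \sum_i m1 i * cell_loss i n); last first.
  rewrite mulrC -mexpZ -(eq_bigr _ (fun i _ => mexpZ m n (m1 i) _)) -mexp_sum -mexpD.
  by apply: eq_mexp => x _; rewrite inner mulrC.
rewrite mulrDl mulrAC mulfV // mul1r mulr_suml; congr (_ + _).
by apply: eq_bigr => i _; rewrite mulrA.
Qed.

End Risk.

(** The common core of both claims, with the expansion of the second-stage risks
    at a fixed sample size as hypothesis. *)
Lemma risk_expansion (d : measure_display) (T : measurableType d)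
    (P : probability T R) (X : nat -> category J -> {RV P >-> nat})
    (Xs : nat -> 'I_I -> {RV P >-> nat}) (s A : 'I_I -> R) :
  (forall n, multinomial_law (X n) n m) ->
  (forall k, multinomial_law (Xs k) k m1) ->
  (forall n k, independent_counts (X n) (Xs k)) ->
  (forall i, o2 (fun N => second_stage_risk i N -
     (s i / (2 * N%:R) + A i / (24 * N%:R ^+ 2)))) ->
  eq_up_to_o2 (fun n k => risk m phat (X n) k (Xs k))
    (fun n k => 1 / (2 * k%:R) * (I%:R - 1)
        + 1 / (2 * n%:R) * \sum_i s i
        + 1 / (12 * k%:R ^+ 2) * (\sum_i (m1 i)^-1 - 1)
        + 1 / (24 * n%:R ^+ 2)
          * \sum_i (m1 i)^-1 * (A i + 12 * (1 - m1 i) * s i)).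
Proof.
move=> lawX lawXs indep sA.
pose a n := \sum_i m1 i * (cell_loss i n / nonempty_prob n) -
  (1 / (2 * n%:R) * \sum_i s i + 1 / (24 * n%:R ^+ 2)
          * \sum_i (m1 i)^-1 * (A i + 12 * (1 - m1 i) * s i)).
pose b k := first_stage_risk k - ((I%:R - 1) / (2 * k%:R) +
  (\sum_i (m1 i)^-1 - 1) / (12 * k%:R ^+ 2)).
exists a, b; split.
- apply/o2P.
  have cell i : o2 (fun n => cell_loss i n / nonempty_prob n -
     (s i / 2 / m1 i / n%:R + (A i / 24 + s i / 2 * (1 - m1 i)) / m1 i ^+ 2 / n%:R ^+ 2)).
    have sA' : o2 (fun N => second_stage_risk i N -
        ((s i / 2) / N%:R + (A i / 24) / N%:R ^+ 2)).
      apply: o2_near (sA i); apply: filterS near_n_gt0 => n n0; congr (_ - _).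
      by field; rewrite pnatr_eq0 -lt0n.
    have := bexp_expansion (first_stage_gt0_le1 i) sA'.
    move=> /(o2D (o2D (conditional_cell_loss_approx i) (cell_loss_approx i))).
    by apply: o2_near; apply: nearW => n; ring.
  apply: o2_near (o2_sum (fun i => o2Z (m1 i) (cell i))).
  apply: filterS near_n_gt0 => n n0; rewrite /a !mulr_sumr -big_split -sumrB /=.
  apply: eq_bigr => i _; rewrite mulrBr; congr (_ - _).
  field; rewrite pnatr_eq0 -lt0n n0 gt_eqF //; exact: first_stage_gt0.
- apply/o2P; have := empirical_KL_expansion first_stage_gt0 first_stage_sum1.
  by rewrite card_ord.
exists ([set n | nonempty_prob n != 0], [set k | (0 < k)%N]) => /=.
  split; last exact: near_n_gt0.
  by apply: filterS nonempty_prob_half => n h; rewrite /= gt_eqF //; lra.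
move=> [n k] /= [Pn k0]; rewrite (@risk_formula _ _ P _ _ n k) //.
by rewrite /a /b; ring.
Qed.

End TwoStage.

Theorem theorem2 (R : realType) (I : nat) (J : 'I_I -> nat)
  (hJ : forall i, (1 <= J i)%N)
  (m : category J -> R)
  (m_gt0 : forall c, 0 < m c) (m_sum1 : \sum_c m c = 1)
  (* second-stage models, with true values p_i, and their MLEs *)
  (s : 'I_I -> nat) (hs : forall i, (s i <= J i - 1)%N)
  (Theta : forall i, set 'rV[R]_(s i))
  (f : forall i, 'rV[R]_(s i) -> 'rV[R]_(J i))
  (hmodel : forall i, parametric_model (Theta i) (@f i))
  (htrue : forall i, (f i @` Theta i) (second_stage m i))
  (phat : forall i, ('I_(J i) -> nat) -> 'rV[R]_(J i))
  (hMLE : forall i (x : 'I_(J i) -> nat), (\sum_j x j)%N <> 0%N ->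
     is_MLE (f i @` Theta i) x (phat i x))
  (* present surveys X n of size n and prior surveys Xs k of size k *)
  (d : measure_display) (T : measurableType d) (P : probability T R)
  (X : nat -> category J -> {RV P >-> nat})
  (Xs : nat -> 'I_I -> {RV P >-> nat})
  (hX : forall n, multinomial_law (X n) n m)
  (hXs : forall k, multinomial_law (Xs k) k (first_stage m))
  (hindep : forall n k, independent_counts (X n) (Xs k)) :
  let m1 := first_stage m in
  let Mf : R := \sum_i (m1 i)^-1 in
  let M : R := \sum_i \sum_(j < J i) (m (Cat j))^-1 in
  let p : R := (\sum_i J i)%N%:R - 1 in
  (forall (d' : measure_display) (T' : measurableType d')
     (P' : probability T' R)
     (Z : forall i, nat -> 'I_(J i) -> {RV P' >-> nat})
     (hZ : forall i k, multinomial_law (Z i k) k (second_stage m i ord0))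
     (A : 'I_I -> R)
     (hA : forall i, second_order_coef (s i) (second_stage m i) (phat i)
                       (Z i) (A i)),
   eq_up_to_o2 (fun n k => risk m phat (X n) k (Xs k))
     (fun n k =>
        1 / (2 * k%:R) * (I%:R - 1)
        + 1 / (2 * n%:R) * \sum_i (s i)%:R
        + 1 / (12 * k%:R ^+ 2) * (Mf - 1)
        + 1 / (24 * n%:R ^+ 2)
          * \sum_i (m1 i)^-1 * (A i + 12 * (1 - m1 i) * (s i)%:R)))
  /\
  ((forall i, full_model (Theta i) (@f i)) ->
   eq_up_to_o2 (fun n k => risk m phat (X n) k (Xs k))
     (fun n k =>
        1 / (2 * k%:R) * (I%:R - 1)
        + 1 / (2 * n%:R) * (p + 1 - I%:R)
        + 1 / (12 * k%:R ^+ 2) * (Mf - 1)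
        + 1 / (12 * n%:R ^+ 2)
          * (M + \sum_i (m1 i)^-1 * (6 * (J i)%:R - 7)
             - 6 * (p + 1 - I%:R)))).

Proof.
move=> m1 Mf M p.
have J_gt0 i : (0 < J i)%N by exact: hJ.
have model_simplex i : f i @` Theta i `<=` @open_simplex R (J i).
  by move=> _ [theta Th <-]; have [_ /(_ _ Th)[]] := hmodel i.
have phat_simplex i x : (\sum_j x j)%N <> 0%N -> closed_simplex (phat i x).
  move=> /hMLE[+ _]; exact: closure_sub_simplex.
split=> [d' T' P' Z hZ A hA|full].
  apply: (risk_expansion J_gt0 m_gt0 m_sum1 phat_simplex hX hXs hindep) => i.
  have := hA i; rewrite /second_order_coef => /o2P.
  apply: o2_near; apply: nearW => k.
  rewrite (multinomial_expectation (fun z => KL (phat i z ord0) _) _ (hZ i k)) //.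
  exact: second_stage_sum1.
(* Twice the coefficient of 1 / (12 N^2) in empirical_KL_expansion. *)
pose A i : R := 2 * (\sum_j (second_stage m i ord0 j)^-1 - 1).
have sE i : (s i)%:R = (J i)%:R - 1 :> R.
  by have [e _] := full i; rewrite e -subn1 natrB.
have sA i : o2 (fun N => second_stage_risk m phat i N -
     ((s i)%:R / (2 * N%:R) + A i / (24 * N%:R ^+ 2))).
  have p0 := second_stage_gt0 J_gt0 m_gt0 (i := i).
  have := empirical_KL_expansion p0 (second_stage_sum1 J_gt0 m_gt0 i).
  apply: o2_near; apply: filterS near_n_gt0 => N N0.
  rewrite card_ord sE; congr (_ - (_ + _)); last first.
    by rewrite /A; field; rewrite pnatr_eq0 -lt0n.
  apply: eq_mexp => z zN; congr (KL _ _); apply/funext => j.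
  have zN0 : (\sum_j z j)%N <> 0%N by rewrite zN; apply/eqP; rewrite -lt0n.
  have := hMLE i z zN0; have [_ e] := full i; rewrite e.
  by move=> /(full_MLE (J_gt0 i) zN0) ->; rewrite zN.
have [a [b [ao bo ab]]] :=
  risk_expansion J_gt0 m_gt0 m_sum1 phat_simplex hX hXs hindep sA.
exists a, b; split => //.
have sumJ : p + 1 - I%:R = \sum_i (s i)%:R.
  under eq_bigr do rewrite sE.
  by rewrite sumrB sumr_const card_ord /p natr_sum subrK.
have coef : 2 * (M + \sum_i (m1 i)^-1 * (6 * (J i)%:R - 7) - 6 * (p + 1 - I%:R)) =
    \sum_i (m1 i)^-1 * (A i + 12 * (1 - m1 i) * (s i)%:R).
  rewrite sumJ /M mulr_sumr -big_split -sumrB mulr_sumr /=.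
  apply: eq_bigr => i _; rewrite /A sE.
  have m1N0 : m1 i != 0 by rewrite gt_eqF //; exact: first_stage_gt0.
  have -> : \sum_j (second_stage m i ord0 j)^-1 = m1 i * \sum_(j < J i) (m (Cat j))^-1.
    by rewrite mulr_sumr; apply: eq_bigr => j _; rewrite mxE invf_div.
  by field.
apply: filterS ab => -[n k] /= ->.
congr (_ + _ + _); rewrite -coef -?sumJ; congr (_ + _).
rewrite mulrA; congr (_ * _); rewrite !invfM; set y := n%:R^-1 / n%:R.
by field.
Qed.
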